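(* Let $f(x,y)=y^{n}+a_{1}(x)y^{n-1}+\cdots+a_{n}(x)\in\mathbb{C}[x,y]$ with $\deg a_i\leqslant i$ for $i=1,\dots,n$ and $n>1$. Put $S_y:=\{z\in\mathbb{C}^2: f_y'(z)=0\}$. If $\mathcal{L}_{\infty}(\nabla f)\leqslant-1$, then (i) there exists $\lambda_{0}\in\mathbb{C}$ such that $\mathcal{L}_{\infty}(\nabla f)=\mathcal{L}_{\infty,\lambda_{0}}(f)$, (ii) $\mathcal{L}_{\infty}(\nabla f)=\mathcal{L}_{\infty}(\nabla f|S_{y})$.
   Context: Here $f_y'=\partial f/\partial y$ and $\nabla f=(f_x',f_y')$. For a polynomial mapping $F:\mathbb{C}^{2}\to\mathbb{C}^{m}$ and an unbounded set $S\subset\mathbb{C}^{2}$ let $N(F|S):=\{\nu\in\mathbb{R}:\exists A,B>0\ \forall z\in S\ (|z|>B\Rightarrow|F(z)|\geqslant A|z|^{\nu})\}$, where $|\cdot|$ is the maximum norm. $\mathcal{L}_\infty(F|S):=\sup N(F|S)$ if $N(F|S)\neq\emptyset$ and $-\infty$ otherwise; $\mathcal{L}_\infty(F):=\mathcal{L}_\infty(F|\mathbb{C}^{2})$. A function meromorphic at infinity is given by a Laurent series $\sum_{m=k}^{-\infty}c_mt^m$, $k\in\mathbb{Z}$, convergent in a punctured neighbourhood of $\infty\in\overline{\mathbb{C}}$; its degree $\deg$ is the largest $m$ with $c_m\ne0$, $\deg 0:=-\infty$; for a tuple of such functions, $\deg$ is the maximum of the degrees of the components. For $\lambda\in\mathbb{C}$,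 $$\mathcal{L}_{\infty,\lambda}(f):=\inf_{\Phi}\frac{\deg(\nabla f\circ\Phi)}{\deg\Phi},$$ the infimum taken over all pairs $\Phi=(\varphi_1,\varphi_2)$ of functions meromorphic at infinity with $\deg\Phi>0$ and $\deg((f-\lambda)\circ\Phi)<0$. *)

(* Defs.v *)
From mathcomp Require Export all_boot all_order all_algebra.
From mathcomp Require Export all_classical all_reals all_analysis.
From mathcomp Require Export complex.
Export Order.TTheory GRing.Theory Num.Theory.
Export numFieldNormedType.Exports.

Set Implicit Arguments.
Unset Strict Implicit.
Unset Printing Implicit Defensive.

Local Open Scope classical_set_scope.
Local Open Scope ring_scope.
Local Open Scope complex_scope.

Section Definitions.
Variable R : realType.

(* The library norm of a row vector over R[i] takes its values in R[i]; this is
   the same maximum norm with values in R. *)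
Definition maxnorm (m : nat) (z : 'rV[R[i]]_m) : R :=
  \big[Num.max/0]_(i < m) Normc.normc (z 0 i).

Definition exponents (m : nat) (F : 'rV[R[i]]_2 -> 'rV[R[i]]_m)
    (S : set 'rV[R[i]]_2) : set R :=
  [set nu : R | exists A B : R, [/\ 0 < A, 0 < B &
    forall z, S z -> B < maxnorm z -> A * maxnorm z `^ nu <= maxnorm (F z)]].

(* With ereal_sup set0 = -oo, an empty set of exponents gives -oo. *)
Definition lojasiewicz (m : nat) (F : 'rV[R[i]]_2 -> 'rV[R[i]]_m)
    (S : set 'rV[R[i]]_2) : \bar R :=
  ereal_sup (EFin @` exponents F S).

(* A function meromorphic at infinity is represented by any total function
   having a Laurent expansion for large |t|; its values elsewhere do not
   matter. Convergence is for the modulus, R[i]^o being R[i] with its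
   canonical topology. *)
Definition laurent_at_infty (phi : R[i] -> R[i]) (k : int) (c : int -> R[i]) :=
  (forall m : int, k < m -> c m = 0) /\
  exists r : R, forall t : R[i], r < Normc.normc t ->
    series (fun j : nat => c (k - j%:Z) * t ^ (k - j%:Z) : R[i]^o) @ \oo
      --> (phi t : R[i]^o).

Definition meromorphic_at_infty (phi : R[i] -> R[i]) :=
  exists k c, laurent_at_infty phi k c.

(* The coefficients c are determined by phi and vanish above k, so for phi
   meromorphic at infinity this is the largest m with c m != 0, and -oo when
   phi vanishes near infinity. *)
Definition degree_at_infty (phi : R[i] -> R[i]) : \bar R :=
  ereal_sup [set (m%:~R)%:E | m in
    [set m : int | exists k c, laurent_at_infty phi k c /\ c m != 0]].

Definition degree_tuple (m : nat) (Phi : R[i] -> 'rV[R[i]]_m) : \bar R :=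
  \big[maxe/-oo%E]_(i < m) degree_at_infty (fun t => Phi t 0 i).

(* In {poly {poly R[i]}} the outer indeterminate 'X is y, the coefficients are
   polynomials in x; a point z has coordinates x = z 0 0 and y = z 0 1. *)
Definition eval2 (f : {poly {poly R[i]}}) (z : 'rV[R[i]]_2) : R[i] :=
  f.[(z 0 1)%:P].[z 0 0].

Definition partial_x (f : {poly {poly R[i]}}) : {poly {poly R[i]}} :=
  map_poly (fun a : {poly R[i]} => a^`()) f.

Definition partial_y (f : {poly {poly R[i]}}) : {poly {poly R[i]}} := f^`().

Definition gradient (f : {poly {poly R[i]}}) (z : 'rV[R[i]]_2) : 'rV[R[i]]_2 :=
  \row_(i < 2) (if i == 0 then eval2 (partial_x f) z else eval2 (partial_y f) z).

Definition polar_curve_y (f : {poly {poly R[i]}}) : set 'rV[R[i]]_2 :=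
  [set z | eval2 (partial_y f) z = 0].

Definition lojasiewicz_at (f : {poly {poly R[i]}}) (lambda : R[i]) : \bar R :=
  ereal_inf [set (degree_tuple (gradient f \o Phi) / degree_tuple Phi)%E |
    Phi in [set Phi : R[i] -> 'rV[R[i]]_2 |
      [/\ forall i, meromorphic_at_infty (fun t => Phi t 0 i),
          (0 < degree_tuple Phi)%E &
          (degree_at_infty (fun t => (eval2 f (Phi t) - lambda)%R) < 0)%E]]].

End Definitions.

(* Main.v *)
From mathcomp Require Import ring lra zify.
Require Import Defs.

Set Implicit Arguments.
Unset Strict Implicit.
Unset Printing Implicit Defensive.

Local Open Scope classical_set_scope.
Local Open Scope ring_scope.
Local Open Scope complex_scope.

(** The polar curve [f_y = 0] splits at infinity into Puiseux branches
    [x = s^-N, y = r_j(s)] with [s] near 0. Given a point [(x, y)] with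
    [|y| <= C |x|], let [r] be the root of [f_y(x, .)] nearest to [y] and expand
    [f(x, r + h) = sum_k b_k h^k] with [h = y - r]. Differentiating along the
    branch with [h] fixed expresses [x f_x(x, r)] through [x f_x(x, y)],
    [f_y(x, y)] and the terms [(s db_k/ds) h^k] with [k >= 2]. Since [b_k] is
    meromorphic in [s], [s db_k/ds] is dominated by [b_k]; and since [r] is the
    nearest root, [sum_(k >= 2) |b_k| |h|^k] is dominated by [|h| |f_y(x, y)|].
    Hence [|f_x(x, r)| <= C |grad f(x, y)|], while for [|y| > C |x|] the gradient
    is at least [|y|^(n-1)]: this is (ii), and the exponent is the least
    [deg f_x(x, r_j) / N]. If it is at most -1 then [s d/ds f = - N x f_x] is
    bounded along the minimizing branch, so [f] has there a finite limit
    lambda0, and that branch realizes the infimum in (i). *)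

(** No theory of holomorphic functions is invoked: an analytic germ is a function with a coefficient
    sequence and remainder bounds A (M |s|)^K for all K. Such bounds pass to sums, products, s ->
    s^k and s d/ds, and they determine the coefficients, which is all that the argument asks of
    analyticity. The obstacle near the polar curve is that the constant must be uniform in y, while
    y is not tied to any curve. This is why h is frozen: the b_k are finitely many germs in s that
    do not depend on y. The assumption that the exponent is at most -1 acts twice. It gives the
    finite limit, and it rules out exponents above n - 1 on the polar curve, which the bound
    |y|^(n-1) in the far region could not transfer to the plane. In (i), the exponent of grad f is
    at most its value at lambda for every lambda, since an exponent can be tested along any curve;
    only the reverse inequality calls for a particular lambda0. *)

Local Notation nrm := Normc.normc.

(** * Germs at 0 and convergent power series *)

Section Modulus.
Variable R : realType.
Implicit Types z w : R[i].

Lemma nrm_ge0 z : 0 <= nrm z.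
Proof. by case: z => a b; exact: sqrtr_ge0. Qed.

Lemma nrm0 : nrm (0 : R[i]) = 0. Proof. exact: Normc.normc0. Qed.

Lemma nrm1 : nrm (1 : R[i]) = 1. Proof. exact: Normc.normc1. Qed.

Lemma nrmM z w : nrm (z * w) = nrm z * nrm w.
Proof. exact: Normc.normcM. Qed.

Lemma nrmV z : nrm z^-1 = (nrm z)^-1. Proof. exact: Normc.normcV. Qed.

Lemma nrmN z : nrm (- z) = nrm z. Proof. exact: normcN. Qed.

Lemma nrmD z w : nrm (z + w) <= nrm z + nrm w. Proof. exact: le_normcD. Qed.

Lemma nrmB z w : nrm (z - w) <= nrm z + nrm w.
Proof. by rewrite -(nrmN w) nrmD. Qed.

Lemma nrmBC z w : nrm (z - w) = nrm (w - z).
Proof. by rewrite -nrmN opprB. Qed.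

Lemma nrm_eq0 z : (nrm z == 0) = (z == 0).
Proof. by apply/eqP/eqP => [/Normc.eq0_normc|->] //; exact: nrm0. Qed.

Lemma nrm_gt0 z : (0 < nrm z) = (z != 0).
Proof. by rewrite lt0r nrm_eq0 nrm_ge0 andbT. Qed.

Lemma nrmX z k : nrm (z ^+ k) = nrm z ^+ k.
Proof. by elim: k => [|k IH]; rewrite ?expr0 ?nrm1 // !exprS nrmM IH. Qed.

Lemma nrm_real (a : R) : nrm a%:C = `|a|.
Proof. by rewrite /= expr0n addr0 sqrtr_sqr. Qed.

Lemma nrm_nat n : nrm (n%:R : R[i]) = n%:R.
Proof. by rewrite -(rmorph_nat (@real_complex R)) nrm_real normr_nat. Qed.

Lemma nrm_sum (I : Type) (r : seq I) (P : pred I) (F : I -> R[i]) :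
  nrm (\sum_(i <- r | P i) F i) <= \sum_(i <- r | P i) nrm (F i).
Proof.
elim/big_ind2: _ => [|z a w b za wb|//]; first by rewrite nrm0.
by rewrite (le_trans (nrmD _ _)) // lerD.
Qed.

Lemma nrm_prod (I : Type) (r : seq I) (P : pred I) (F : I -> R[i]) :
  nrm (\prod_(i <- r | P i) F i) = \prod_(i <- r | P i) nrm (F i).
Proof. by elim/big_ind2: _ => [|z a w b <- <-|//]; rewrite ?nrm1 ?nrmM. Qed.

Lemma nrm_subr_ge z w : nrm z - nrm w <= nrm (z - w).
Proof. by rewrite lerBlDr -{1}(subrK w z) nrmD. Qed.

Lemma nrmC z : `|z| = (nrm z)%:C.
Proof. by case: z. Qed.

End Modulus.

Section PuncturedGerms.
Variable R : realType.

(* Germs at 0 of functions that need not be defined at 0 itself. *)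
Definition punctured0 : set_system R[i] :=
  [set P | exists2 e : R, 0 < e & forall s, 0 < nrm s < e -> P s].

Global Instance punctured0_filter : ProperFilter punctured0.
Proof.
apply: Build_ProperFilter_ex; last split.
- move=> P [e e0 He]; exists (e / 2)%:C; apply: He.
  by rewrite nrm_real ger0_norm; lra.
- by exists 1.
- move=> P Q [e e0 He] [d d0 Hd]; exists (Num.min e d); first by rewrite lt_min e0.
  by move=> s; rewrite lt_min => /and3P[s0 se sd]; split;
    [apply: He; rewrite s0|apply: Hd; rewrite s0].
- by move=> P Q PQ [e e0 He]; exists e => // s /He /PQ.
Qed.

Lemma punctured0_lt (e : R) : 0 < e -> \forall s \near punctured0, nrm s < e.
Proof. by move=> e0; exists e => // s /andP[]. Qed.

Lemma punctured0_neq0 : \forall s \near punctured0, s != 0.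
Proof. by exists 1 => // s /andP[]; rewrite nrm_gt0. Qed.

Lemma punctured0_exp (P : set R[i]) k : (0 < k)%N ->
  (\forall s \near punctured0, P s) -> \forall s \near punctured0, P (s ^+ k).
Proof.
move=> k0 [e e0 He]; exists (Num.min 1 e); first by rewrite lt_min ltr01.
move=> s; rewrite lt_min => /and3P[s0 s1 se]; apply: He.
rewrite nrmX exprn_gt0 //= (le_lt_trans _ se) //.
case: k k0 => // k _; rewrite exprS ger_pMr //.
by rewrite exprn_ile1 // ltW.
Qed.

End PuncturedGerms.
Arguments punctured0 {R}.

Section Expansions.
Variable R : realType.
Implicit Types (c d : nat -> R[i]) (phi psi : R[i] -> R[i]).

(* A topology-free form of phi s = \sum_n c n s^n near 0, s != 0. *)
Definition dominated (A M : R) c phi := forall s, s != 0 -> M * nrm s <= 1 ->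
  forall K, nrm (phi s - \sum_(n < K) c n * s ^+ n) <= A * (M * nrm s) ^+ K.

Definition expansion c phi := exists A M : R, 0 < M /\ dominated A M c phi.

Lemma dominated_le A M A' M' c phi : 0 < M -> M <= M' -> A <= A' ->
  dominated A M c phi -> dominated A' M' c phi.
Proof.
move=> M0 MM' AA' H s s0 sM' K.
have s_ge0 := nrm_ge0 s.
have sM : M * nrm s <= 1 by rewrite (le_trans _ sM')// ler_wpM2r.
have A0 : 0 <= A by have := H s s0 sM 0%N; rewrite expr0 mulr1; apply: le_trans (nrm_ge0 _).
apply: (le_trans (H s s0 sM K)); apply: ler_pM => //.
  by rewrite exprn_ge0// mulr_ge0// ltW.
by apply: lerXn2r; rewrite ?nnegrE ?mulr_ge0// ?ler_wpM2r//; lra.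
Qed.

Lemma expansion_large c phi A0 M0 : expansion c phi ->
  exists A M, [/\ A0 <= A, M0 <= M, 0 < M & dominated A M c phi].
Proof.
move=> [A [M [M_gt0 H]]]; exists (Num.max A A0), (Num.max M M0).
split; rewrite ?le_max ?lt_max ?lexx ?orbT ?M_gt0//.
by apply: dominated_le H; rewrite ?le_max ?lexx.
Qed.

Lemma expansion_eq c phi psi : (\forall s \near punctured0, phi s = psi s) ->
  expansion c phi -> expansion c psi.
Proof.
(* Taking [M] at least 2 / e confines the disc M |s| <= 1 to |s| <= e / 2, where [phi] and [psi]
   agree. *)
move=> [e e0 He] /(expansion_large 0 (2 / e)) [A [M [A0 M2 M0 H]]].
exists A, M; split=> // s s0 sM K; rewrite -He; first exact: H.
rewrite nrm_gt0 s0 /=.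
have : 2 / e * nrm s <= 1 by rewrite (le_trans _ sM)// ler_wpM2r// nrm_ge0.
have s_gt0 : 0 < nrm s by rewrite nrm_gt0.
by rewrite mulrAC ler_pdivrMr//; lra.
Qed.

(** At |s| = 1 / M the term c_n s^n is the difference of the remainders of orders n and n + 1, each
    at most [A]. *)
Lemma dominated_coef A M c phi n : 0 < M -> dominated A M c phi ->
  nrm (c n) <= 2 * A * M ^+ n.
Proof.
move=> M0 H; pose s : R[i] := (M^-1)%:C.
have ns : nrm s = M^-1 by rewrite nrm_real gtr0_norm ?invr_gt0.
have Ms : M * nrm s = 1 by rewrite ns divff// gt_eqF.
have s0 : s != 0 by rewrite -nrm_gt0 nrm_real normr_gt0 invr_eq0 gt_eqF.
have H1 := H s s0; rewrite Ms in H1.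
have := le_trans (nrmB _ _) (lerD (H1 (lexx _) n) (H1 (lexx _) n.+1)).
rewrite big_ord_recr /= !expr1n !mulr1.
set S := \sum_(_ < _) _; have -> : phi s - S - (phi s - (S + c n * s ^+ n)) = c n * s ^+ n by ring.
rewrite nrmM nrmX ns exprVn ler_pdivrMr ?exprn_gt0// => /le_trans; apply.
by rewrite mulr2n [_ * A]mulrDl mul1r.
Qed.

Lemma expansion_cst a : expansion (fun n => a *+ (n == 0%N)) (fun=> a).
Proof.
exists (nrm a), 1; split=> // s _ s1 [|K].
  by rewrite big_ord0 subr0 expr0 mulr1.
rewrite big_ord_recl big1 ?addr0 ?expr0 ?mulr1 ?subrr ?nrm0; last first.
  by move=> i _; rewrite /= mulr0n mul0r.
by rewrite mulr_ge0 ?exprn_ge0 ?mulr_ge0 ?nrm_ge0.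
Qed.

Lemma expansion_var : expansion (fun n => (n == 1%N)%:R) id.
Proof.
exists 1, 1; split=> // s _ s1 [|[|K]].
- by rewrite big_ord0 subr0 expr0 mulr1 -[nrm _]mul1r.
- by rewrite big_ord1 mul0r subr0 expr1 !mul1r.
rewrite 2!big_ord_recl big1 ?addr0 ?mul0r ?add0r ?expr1 /= ?mul1r ?subrr ?nrm0; last first.
  by move=> i _; rewrite /= mul0r.
by rewrite exprn_ge0 ?nrm_ge0.
Qed.

Lemma expansion_add c d phi psi : expansion c phi -> expansion d psi ->
  expansion (fun n => c n + d n) (fun s => phi s + psi s).
Proof.
move=> [A [M [M0 Hc]]] /(expansion_large 0 M) [B [N [_ MN N0 Hd]]].
exists (A + B), N; split=> // s s0 sN K.
under eq_bigr do rewrite mulrDl.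
rewrite big_split opprD addrACA mulrDl (le_trans (nrmD _ _))// lerD//; last exact: Hd.
exact: (dominated_le M0 MN (lexx A) Hc).
Qed.

(** The triangle i + j < K is summed by antidiagonals and by rows; this serves Cauchy products of
    expansions, of polynomials and of majorants alike. *)
Lemma triangle_sum (A : pzSemiRingType) (u v : nat -> A) K :
  \sum_(n < K) \sum_(i < n.+1) u i * v (n - i)%N =
  \sum_(i < K) u i * \sum_(j < K - i) v j.
Proof.
elim: K => [|K IH]; first by rewrite !big_ord0.
rewrite big_ord_recr IH [RHS]big_ord_recr /= [X in _ + X]big_ord_recr /= addrA.
rewrite subSnn subnn big_ord1 -big_split /=; congr (_ + _).
by apply: eq_bigr => i _; rewrite subSn ?(ltnW (ltn_ord i))// big_ord_recr mulrDr.
Qed.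

Lemma leq_double_exp2 k : (k.*2.+2 <= 2 ^ k.+1)%N.
Proof. by elim: k => // k IH; rewrite doubleS expnS; lia. Qed.

(** With q = M |s|, the remainder of the product consists of K cross terms of size at most 2 A^2 q^K
    and one term of size at most A^2 q^K. Doubling [M] supplies the factor 2^K that absorbs 2 K +
    1. *)
Lemma expansion_mul c d phi psi : expansion c phi -> expansion d psi ->
  expansion (fun n => \sum_(i < n.+1) c i * d (n - i)%N) (fun s => phi s * psi s).
Proof.
move=> [A0 [M0 [M00 Hc0]]] /(expansion_large A0 M0) [A [M [AA MM M_gt0 Hd]]].
have Hc := dominated_le M00 MM AA Hc0.
exists (2 * A ^+ 2), (2 * M); split=> [|s s0 s2M K]; first by rewrite mulr_gt0.
have s_ge0 := nrm_ge0 s; set q := M * nrm s.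
have q0 : 0 <= q by rewrite mulr_ge0// ltW.
have q1 : q <= 1 by rewrite /q; lra.
have psiA : nrm (psi s) <= A.
  by have := Hd s s0 q1 0%N; rewrite big_ord0 subr0 expr0 mulr1.
have A_ge0 : 0 <= A by rewrite (le_trans _ psiA) ?nrm_ge0.
under eq_bigr => n _.
  rewrite mulr_suml; under eq_bigr => i _.
    rewrite (_ : s ^+ n = s ^+ i * s ^+ (n - i)); last by rewrite -exprD subnKC// leq_ord.
    rewrite mulrACA.
  over.
over.
rewrite (triangle_sum (fun i => c i * s ^+ i) (fun i => d i * s ^+ i)).
have -> : phi s * psi s - \sum_(i < K) c i * s ^+ i * (\sum_(j < K - i) d j * s ^+ j) =
  \sum_(i < K) c i * s ^+ i * (psi s - \sum_(j < K - i) d j * s ^+ j) +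
  (phi s - \sum_(i < K) c i * s ^+ i) * psi s.
  under [in RHS]eq_bigr do rewrite mulrBr.
  by rewrite sumrB -mulr_suml; ring.
have -> : 2 * A ^+ 2 * (2 * M * nrm s) ^+ K = A ^+ 2 * q ^+ K * 2 ^+ K.+1.
  rewrite /q !exprMn !exprS. ring.
have H1 : (K.*2.+1%:R : R) <= 2 ^+ K.+1.
  by rewrite -natrX ler_nat ltnW// leq_double_exp2.
apply: (@le_trans _ _ (A ^+ 2 * q ^+ K * K.*2.+1%:R)); last first.
  by rewrite ler_wpM2l// mulr_ge0// exprn_ge0.
rewrite -natr1 mulrDr mulr1 (le_trans (nrmD _ _))// lerD//; last first.
  rewrite nrmM expr2 mulrAC ler_pM ?nrm_ge0//; exact: Hc.
rewrite (le_trans (nrm_sum _ _ _))//.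
rewrite (@le_trans _ _ (\sum_(i < K) 2 * (A ^+ 2 * q ^+ K)))//; last first.
  by rewrite sumr_const card_ord -mulr_natr -mul2n natrM; lra.
apply: ler_sum => i _.
rewrite (_ : q ^+ K = q ^+ i * q ^+ (K - i)); last by rewrite -exprD subnKC// ltnW.
rewrite nrmM.
have -> : 2 * (A ^+ 2 * (q ^+ i * q ^+ (K - i))) = (2 * A * q ^+ i) * (A * q ^+ (K - i)) by ring.
apply: ler_pM; rewrite ?nrm_ge0//; last exact: Hd.
rewrite nrmM nrmX /q exprMn mulrA ler_wpM2r ?exprn_ge0//.
exact: dominated_coef Hc.
Qed.

Lemma geometric_le0 (x A q : R) : 0 <= q <= 2^-1 -> (forall K, x <= A * q ^+ K) -> x <= 0.
Proof.
move=> /andP[q0 q1] H; rewrite leNgt; apply/negP => x0.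
have A0 : 0 < A by have := H 0%N; rewrite expr0; lra.
pose K := Num.bound (A / x).
have := upper_nthrootP (leqnn K); rewrite ltr_pdivrMr// mulrC => AK.
have := H K; rewrite leNgt => /negP; apply.
apply: (@le_lt_trans _ _ (A * 2^-1 ^+ K)); first by rewrite ler_pM2l// lerXn2r ?nnegrE; lra.
by rewrite exprVn ltr_pdivrMr ?exprn_gt0.
Qed.

Lemma expansion0 c phi : expansion c phi -> (forall n, c n = 0) ->
  \forall s \near punctured0, phi s = 0.
Proof.
move=> [A [M [M0 H]]] c0; exists (2 * M)^-1; first by rewrite invr_gt0 mulr_gt0.
move=> s; rewrite nrm_gt0 => /andP[s0 sM].
have {}sM : M * nrm s <= 2^-1.
  have : nrm s * (2 * M) < 1 by rewrite -ltr_pdivlMr ?mulr_gt0// mul1r.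
  lra.
apply/eqP; rewrite -nrm_eq0; apply/eqP/le_anti; rewrite nrm_ge0 andbT.
apply: (@geometric_le0 _ A (M * nrm s)) => [|K].
  by rewrite sM mulr_ge0 ?nrm_ge0 ?ltW.
have := H s s0 _ K; rewrite big1 ?subr0; first by apply; lra.
by move=> i _; rewrite c0 mul0r.
Qed.

Lemma expansion_unit c phi : expansion c phi -> c 0%N != 0 ->
  \forall s \near punctured0, nrm (c 0%N) / 2 <= nrm (phi s) <= 2 * nrm (c 0%N).
Proof.
move=> /(expansion_large 1 0) [A [M [A1 _ M0 H]]] c0.
have nc0 : 0 < nrm (c 0%N) by rewrite nrm_gt0.
(* The second radius keeps the remainder of order 1, at most A M |s|, below half of |c_0|. *)
exists (Num.min M^-1 (nrm (c 0%N) / (2 * A * M))).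
  by rewrite lt_min invr_gt0 M0 divr_gt0// !mulr_gt0//; lra.
move=> s; rewrite lt_min nrm_gt0 => /and3P[s0 s1 s2].
have sM : M * nrm s <= 1 by rewrite mulrC -ler_pdivlMr// mul1r ltW.
have := H s s0 sM 1%N; rewrite big_ord1 expr0 mulr1 expr1.
have : A * (M * nrm s) <= nrm (c 0%N) / 2.
  move: s2; rewrite ltr_pdivlMr; last by rewrite !mulr_gt0//; lra.
  by move=> /ltW; lra.
have := nrm_subr_ge (c 0%N) (phi s); have := nrm_subr_ge (phi s) (c 0%N).
rewrite (nrmBC (c 0%N)); lra.
Qed.

Lemma expansion_shift c phi k : expansion c phi -> (forall n, (n < k)%N -> c n = 0) ->
  exists psi, expansion (fun n => c (k + n)%N) psi /\ forall s, s != 0 -> phi s = s ^+ k * psi s.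
Proof.
move=> [A [M [M0 H]]] c0; exists (fun s => phi s / s ^+ k); split; last first.
  by move=> s s0; rewrite mulrC divfK// expf_eq0 (negbTE s0) andbF.
exists (A * M ^+ k), M; split=> // s s0 sM K.
have sk0 : s ^+ k != 0 by rewrite expf_eq0 (negbTE s0) andbF.
have -> : phi s / s ^+ k - \sum_(n < K) c (k + n)%N * s ^+ n =
  (phi s - \sum_(n < k + K) c n * s ^+ n) / s ^+ k.
  rewrite mulrBl; congr (_ - _); rewrite big_split_ord /=.
  rewrite [X in (X + _) / _]big1 => [|i _]; last by rewrite c0 ?mul0r.
  by rewrite add0r mulr_suml; apply: eq_bigr => i _; rewrite exprD; field.
rewrite nrmM nrmV ler_pdivrMr ?nrm_gt0// nrmX (le_trans (H s s0 sM _))//.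
by rewrite exprD exprMn; lra.
Qed.

Lemma expansion_lead c phi : expansion c phi ->
  (forall n, c n = 0) \/
  exists k psi, [/\ c k != 0, forall n, (n < k)%N -> c n = 0,
    expansion (fun n => c (k + n)%N) psi &
    forall s, s != 0 -> phi s = s ^+ k * psi s].
Proof.
move=> H; case: (pselect (exists n, c n != 0)) => [ex|nex]; last first.
  by left=> n; apply/eqP/negP => cn; apply: nex; exists n; apply/negP.
right; case: (ex_minnP ex) => k ck min_k; exists k.
have cz n : (n < k)%N -> c n = 0.
  by move=> nk; apply/eqP/negPn/negP => /min_k; rewrite leqNgt nk.
by have [psi [Hpsi E]] := expansion_shift H cz; exists psi.
Qed.

Lemma expansion_opp c phi : expansion c phi ->
  expansion (fun n => - c n) (fun s => - phi s).
Proof.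
move=> [A [M [M0 H]]]; exists A, M; split=> // s s0 sM K.
have := H s s0 sM K; rewrite -nrmN opprB addrC.
by under [in X in _ -> X]eq_bigr do rewrite mulNr; rewrite sumrN opprK addrC.
Qed.

Lemma expansion_inj c phi psi : expansion c phi -> expansion c psi ->
  \forall s \near punctured0, phi s = psi s.
Proof.
move=> Hphi /expansion_opp Hpsi.
have := expansion0 (expansion_add Hphi Hpsi) _ => /(_ (fun n => subrr _)).
by apply: filterS => s /eqP; rewrite subr_eq0 => /eqP.
Qed.

(** If the difference had a leading coefficient, it would be s^k times a germ bounded away from 0,
    hence nonzero near 0. *)
Lemma expansion_uniq c d phi psi : (\forall s \near punctured0, phi s = psi s) ->
  expansion c phi -> expansion d psi -> c =1 d.
Proof.
move=> phipsi /(expansion_eq phipsi) Hc /expansion_opp Hd.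
have [H n|[k [chi [cd _ Hchi E]]]] := expansion_lead (expansion_add Hc Hd).
  by apply/eqP; rewrite -subr_eq0 H.
have := expansion_unit Hchi; rewrite addn0 => /(_ cd) H.
exfalso; near (@punctured0 R) => s.
have s0 : s != 0 by near: s; exact: punctured0_neq0.
have : nrm (c k - d k) / 2 <= nrm (chi s).
  by near: s; apply: filterS H => s /andP[].
have /eqP := E s s0; rewrite subrr eq_sym mulf_eq0 expf_eq0 (negbTE s0) andbF /= => /eqP ->.
rewrite nrm0; move: cd; rewrite -nrm_gt0; lra.
Unshelve. all: by end_near. Qed.

Lemma expansion_comp c phi k : (0 < k)%N -> expansion c phi ->
  expansion (fun n => if (k %| n)%N then c (n %/ k)%N else 0) (fun s => phi (s ^+ k)).
Proof.
move=> k0 /(expansion_large 0 1) [A [M [A0 M1 M0 H]]].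
exists A, M; split=> // s s0 sM K.
have s_ge0 := nrm_ge0 s.
(* [J] is K / k rounded up, the number of multiples of [k] below [K]: only these contribute to the
   partial sum. *)
pose J := ((K + k.-1) %/ k)%N.
have -> : \sum_(n < K) (if (k %| n)%N then c (n %/ k)%N else 0) * s ^+ n =
          \sum_(n < J) c n * (s ^+ k) ^+ n.
  rewrite /J; elim: (K) => [|m IH].
    by rewrite divn_small ?big_ord0// add0n prednK.
  rewrite big_ord_recr IH /= addSn divnS// -addnS prednK// dvdn_addl//.
  case: ifP => km; last by rewrite mul0r addr0 add0n.
  rewrite add1n big_ord_recr /=; congr (_ + _).
  have -> : ((m + k.-1) %/ k)%N = (m %/ k)%N.
    by case/dvdnP: km => j ->; rewrite mulnK// divnMDl// divn_small ?addn0// prednK.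
  by rewrite -exprM mulnC divnK.
have q1 : (M * nrm s) ^+ k <= 1 by rewrite exprn_ile1// mulr_ge0// ltW.
have sk : M * nrm (s ^+ k) <= (M * nrm s) ^+ k.
  rewrite nrmX exprMn ler_wpM2r ?exprn_ge0//.
  by case: (k) k0 => // k' _; rewrite exprS ler_peMr ?exprn_ege1// ltW.
apply: le_trans (H _ _ (le_trans sk q1) J) _.
  by rewrite expf_eq0 (negbTE s0) andbF.
rewrite ler_wpM2l//.
apply: (@le_trans _ _ (((M * nrm s) ^+ k) ^+ J)).
  by apply: lerXn2r; rewrite ?nnegrE ?mulr_ge0 ?nrm_ge0 ?exprn_ge0 ?mulr_ge0 // ltW.
rewrite -exprM; apply: ler_wiXn2l => //; first by rewrite mulr_ge0// ltW.
have := divn_eq (K + k.-1) k; have := ltn_pmod (K + k.-1) k0; rewrite -/J; clear; lia.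
Qed.

Lemma geometric_limit_real (a : nat -> R) (B q : R) : 0 <= q <= 2^-1 ->
  (forall n, `|a n| <= B * q ^+ n) ->
  exists l, forall K, `|l - \sum_(n < K) a n| <= 2 * B * q ^+ K.
Proof.
move=> /andP[q0 q1] aB.
have B0 : 0 <= B by have := aB 0%N; rewrite expr0 mulr1; apply: le_trans.
have tail K J : `|\sum_(n < K + J) a n - \sum_(n < K) a n| <= 2 * B * q ^+ K.
  rewrite big_split_ord /= addrAC subrr add0r (le_trans (ler_norm_sum _ _ _))//.
  have : \sum_(i < J) `|a (K + i)%N| <= 2 * B * q ^+ K * (1 - 2^-1 ^+ J).
    elim: J => [|J IH]; first by rewrite big_ord0 expr0 subrr mulr0.
    rewrite big_ord_recr /= (le_trans (lerD IH (aB _)))//.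
    rewrite exprD exprS.
    have : B * q ^+ K * q ^+ J <= B * q ^+ K * 2^-1 ^+ J.
      by rewrite ler_wpM2l ?mulr_ge0 ?exprn_ge0// lerXn2r ?nnegrE; lra.
    lra.
  move=> /le_trans; apply; rewrite ler_piMr ?(mulr_ge0, exprn_ge0)//.
pose u : R^nat := series a.
have uE n : u n = \sum_(i < n) a i by rewrite /u seriesEord.
have cu : cvgn u.
  apply: normed_cvg; apply: (series_le_cvg (v_ := geometric B q)) => [n|n|n|] //=.
  - by rewrite mulr_ge0// exprn_ge0.
  - by apply: is_cvg_geometric_series; rewrite ger0_norm//; lra.
exists (limn u) => K.
have cK : (fun J => `|u J - u K|) @ \oo --> `|limn u - u K|.
  by apply: cvg_norm; apply: cvgB cu _; exact: cvg_cst.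
rewrite -uE -(cvg_lim _ cK)//; apply: limr_le (cvgP _ cK) _.
by near=> J; rewrite !uE -(subnKC (_ : K <= J)%N)//; near: J; exact: nbhs_infty_ge.
Unshelve. all: by end_near. Qed.

Lemma Re_nrm (z : R[i]) : `|complex.Re z| <= nrm z.
Proof. by have := normc_ge_Re z; rewrite nrmC lecR. Qed.

Lemma Im_nrm (z : R[i]) : `|complex.Im z| <= nrm z.
Proof.
case: z => a b; have := Re_nrm ((a +i* b) * (0 +i* 1)); rewrite nrmM.
have -> : nrm (0 +i* 1 : R[i]) = 1 by rewrite /= expr0n expr1n add0r sqrtr1.
by rewrite mulr1 /= mulr0 sub0r mulr1 normrN.
Qed.

(** Convergence is taken on real and imaginary parts separately, which costs the factor 2 between
    this constant and the real one. *)
Lemma geometric_limit (a : nat -> R[i]) (B q : R) : 0 <= q <= 2^-1 ->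
  (forall n, nrm (a n) <= B * q ^+ n) ->
  exists l, forall K, nrm (l - \sum_(n < K) a n) <= 4 * B * q ^+ K.
Proof.
move=> q01 aB.
have [x Hx] := geometric_limit_real q01 (fun n => le_trans (Re_nrm _) (aB n)).
have [y Hy] := geometric_limit_real q01 (fun n => le_trans (Im_nrm _) (aB n)).
exists (x +i* y) => K.
have -> : x +i* y - \sum_(n < K) a n =
    (x - \sum_(n < K) complex.Re (a n))%:C + (0 +i* 1) * (y - \sum_(n < K) complex.Im (a n))%:C.
  apply/eqP; rewrite eq_complex !raddfB/= !raddf_sum/=.
  by apply/andP; split; apply/eqP; simpc => /=; ring.
rewrite (le_trans (nrmD _ _))// nrmM !nrm_real.
have -> : nrm (0 +i* 1 : R[i]) = 1 by rewrite /= expr0n expr1n add0r sqrtr1.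
by have := Hx K; have := Hy K; lra.
Qed.

Lemma expansion_exists c (A M : R) : 0 < M -> (forall n, nrm (c n) <= A * M ^+ n) ->
  exists phi, expansion c phi.
Proof.
move=> M0 cA.
have A0 : 0 <= A by have := cA 0%N; rewrite expr0 mulr1; apply: le_trans (nrm_ge0 _).
have /choice[phi Hphi] : forall s, exists l, 2 * M * nrm s <= 1 ->
    forall K, nrm (l - \sum_(n < K) c n * s ^+ n) <= 4 * A * (M * nrm s) ^+ K.
  (* The default value 0 is taken where 2 M |s| > 1, outside the disc of the expansion built below;
     the factor 2 makes the ratio at most 1/2. *)
  move=> s; have [s1|s1] := leP (2 * M * nrm s) 1; last by exists 0.
  have [|n|l Hl] := @geometric_limit (fun n => c n * s ^+ n) A (M * nrm s).
  - by apply/andP; split; [rewrite mulr_ge0 ?nrm_ge0// ltW|lra].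
  - by rewrite nrmM nrmX exprMn mulrA ler_wpM2r ?exprn_ge0 ?nrm_ge0.
  - by exists l.
exists phi; exists (4 * A), (2 * M); split=> [|s s0 s1 K]; first by rewrite mulr_gt0.
have s_ge0 := nrm_ge0 s.
rewrite (le_trans (Hphi s s1 K))// ler_wpM2l ?mulr_ge0//.
apply: lerXn2r; rewrite ?nnegrE ?mulr_ge0//; try lra.
have := mulr_ge0 (ltW M0) s_ge0; lra.
Qed.

End Expansions.

(** * Hensel's lemma and Puiseux's theorem *)

Lemma ler_sum_widen (R : numDomainType) m n (F : nat -> R) : (m <= n)%N ->
  (forall i, 0 <= F i) -> \sum_(i < m) F i <= \sum_(i < n) F i.
Proof.
move=> mn F0; rewrite -(subnKC mn) big_split_ord /= lerDl.
by apply: sumr_ge0.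
Qed.

Section CoefficientNorm.
Variable (R : realType) (D : nat).
Implicit Types p q : {poly R[i]}.

Definition coef_norm p : R := \sum_(i < D) nrm p`_i.

Lemma coef_norm_ge0 p : 0 <= coef_norm p.
Proof. by apply: sumr_ge0 => i _; apply: nrm_ge0. Qed.

Lemma coef_norm_coef p i : (i < D)%N -> nrm p`_i <= coef_norm p.
Proof.
move=> iD; rewrite /coef_norm (bigD1 (Ordinal iD))//= lerDl.
by apply: sumr_ge0 => j _; apply: nrm_ge0.
Qed.

Lemma coef_normD p q : coef_norm (p + q) <= coef_norm p + coef_norm q.
Proof.
by rewrite -big_split ler_sum// => i _; rewrite coefD nrmD.
Qed.

Lemma coef_normN p : coef_norm (- p) = coef_norm p.
Proof. by apply: eq_bigr => i _; rewrite coefN nrmN. Qed.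

Lemma coef_norm0 : coef_norm 0 = 0.
Proof. by apply: big1 => i _; rewrite coef0 nrm0. Qed.

Lemma coef_normZ a p : coef_norm (a *: p) = nrm a * coef_norm p.
Proof. by rewrite /coef_norm mulr_sumr; apply: eq_bigr => i _; rewrite coefZ nrmM. Qed.

Lemma coef_norm_sum n (F : 'I_n -> {poly R[i]}) :
  coef_norm (\sum_(i < n) F i) <= \sum_(i < n) coef_norm (F i).
Proof.
elim/big_ind2: _ => [|p x q y px qy|//]; first by rewrite coef_norm0.
by rewrite (le_trans (coef_normD _ _))// lerD.
Qed.

(** Truncation at [D] coefficients only drops terms from the product of the two sums. *)
Lemma coef_normM p q : coef_norm (p * q) <= coef_norm p * coef_norm q.
Proof.
apply: (@le_trans _ _ (\sum_(n < D) \sum_(i < n.+1) nrm p`_i * nrm q`_(n - i))).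
  apply: ler_sum => n _; rewrite coefM (le_trans (nrm_sum _ _ _))//.
  by apply: ler_sum => i _; rewrite nrmM.
rewrite (triangle_sum (fun i => nrm p`_i) (fun i => nrm q`_i)) mulr_suml.
apply: ler_sum => i _; rewrite ler_wpM2l ?nrm_ge0//.
by apply: (@ler_sum_widen _ _ _ (fun j => nrm q`_j)); rewrite ?leq_subr// => j; apply: nrm_ge0.
Qed.

(** Finite dimension bounds the operator: the constant is the sum of the norms of the images of the
    monomials of degree below [m]. *)
Lemma coef_norm_linear (T : {poly R[i]} -> {poly R[i]}) m : (m <= D)%N ->
  (forall p q, T (p + q) = T p + T q) -> (forall a p, T (a *: p) = a *: T p) ->
  exists2 K, 0 <= K & forall p, (size p <= m)%N -> coef_norm (T p) <= K * coef_norm p.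
Proof.
move=> mD TD TZ; exists (\sum_(i < m) coef_norm (T 'X^i)).
  by apply: sumr_ge0 => i _; apply: coef_norm_ge0.
have T0 : T 0 = 0 by have := TZ 0 0; rewrite !scale0r.
move=> p pm; rewrite {1}(_ : p = \sum_(i < m) p`_i *: 'X^i); last first.
  rewrite -poly_def; apply/polyP => i; rewrite coef_poly.
  by case: ltnP => // mi; rewrite nth_default// (leq_trans pm).
rewrite (big_morph T TD T0) (le_trans (coef_norm_sum _))// mulr_suml.
apply: ler_sum => i _; rewrite TZ coef_normZ mulrC ler_wpM2l ?coef_norm_ge0//.
exact/coef_norm_coef/(leq_trans (ltn_ord i)).
Qed.

End CoefficientNorm.

Lemma size_polyM_le (F : nzRingType) (p q : {poly F}) m a b :
  (size p < a)%N -> (size q <= b)%N -> (a + b = m.+2)%N -> (size (p * q)%R <= m)%N.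
Proof. by move=> pa qb ab; rewrite (leq_trans (size_polyMleq _ _))//; lia. Qed.

Section Hensel.
Variable R : realType.

(** This solves the linearization of the factorization at (g, h). From u g + v h = 1 one takes G = v
    r mod g and H = (r - G h) / g; both depend linearly on r, so one constant bounds all solutions.
    The size hypothesis sits inside the existential so that [choice] yields a solution function on
    all polynomials. *)
Lemma hensel_step m (g h : {poly R[i]}) : g \is monic -> h \is monic ->
    (size g + size h = m.+2)%N -> coprimep g h ->
  exists2 K : R, 0 <= K & forall r : {poly R[i]}, exists GH : {poly R[i]} * {poly R[i]},
    (size r <= m)%N ->
    [/\ (size GH.1 < size g)%N, (size GH.2 < size h)%N, g * GH.2 + GH.1 * h = r,
        coef_norm m.+1 GH.1 <= K * coef_norm m.+1 r &
        coef_norm m.+1 GH.2 <= K * coef_norm m.+1 r].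
Proof.
move=> mg mh sgh /Bezout_eq1_coprimepP [[u v] /= uv].
have g0 : g != 0 by rewrite monic_neq0.
pose S r := (v * r) %% g; pose T r := (r - S r * h) %/ g.
have SD p q : S (p + q) = S p + S q by rewrite /S mulrDr modpD.
have SZ a p : S (a *: p) = a *: S p by rewrite /S -scalerAr modpZl.
have TD p q : T (p + q) = T p + T q.
  by rewrite /T SD mulrDl opprD addrACA divpD.
have TZ a p : T (a *: p) = a *: T p.
  by rewrite /T SZ -scalerAl -scalerBr divpZl.
have [K1 K10 HS] := coef_norm_linear (leqnSn m) SD SZ.
have [K2 K20 HT] := coef_norm_linear (leqnSn m) TD TZ.
exists (K1 + K2) => [|r]; first by rewrite addr_ge0.
exists (S r, T r) => /= rm.
have sS : (size (S r) < size g)%N by rewrite ltn_modp.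
have nr := coef_norm_ge0 m.+1 r.
have sg : (0 < size g)%N by rewrite size_poly_gt0.
have sh : (0 < size h)%N by rewrite size_poly_gt0 monic_neq0.
split=> //.
- rewrite /T size_divp//; apply: leq_ltn_trans (leq_sub2r (size g).-1 (_ : _ <= m)%N) _.
    by rewrite (leq_trans (size_polyD _ _))// geq_max rm size_polyN (size_polyM_le sS _ sgh).
  rewrite (_ : m = (size g).-1 + (size h).-1)%N ?addKn ?prednK//.
  by apply/succn_inj/succn_inj; rewrite -sgh -addnS -addSn !prednK.
- have dvd : g %| r - S r * h.
    have E : v * r - S r = (v * r) %/ g * g by rewrite {1}(divp_eq (v * r) g) addrK.
    rewrite (_ : r - S r * h = (u * r + (v * r) %/ g * h) * g) ?dvdp_mulIr//.
    rewrite mulrDl [_ * h * g]mulrAC -E -[X in X - _]mul1r -uv; ring.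
  by rewrite -[RHS](subrK (S r * h)) -[X in _ = X + _](divpK dvd) [in RHS]mulrC.
- by rewrite (le_trans (HS r rm))// ler_wpM2r// lerDl.
- by rewrite (le_trans (HT r rm))// ler_wpM2r// lerDr.
Qed.

(** Course-of-values recursion, needed because each Hensel coefficient depends on all earlier
    ones. *)
Lemma strong_recursion (T : Type) (F : seq T -> T) :
  exists u : nat -> T, forall k, u k = F (mkseq u k).
Proof.
pose hist k := iter k (fun h => rcons h (F h)) [::].
exists (fun k => F (hist k)) => k; congr F.
by elim: k => // k IH; rewrite mkseqS -IH.
Qed.

(* Weighting by powers of a small rho turns the convolution inequality into
   S' <= e + K S^2 for the partial sums, which preserves S <= 2 e. *)
Lemma convolution_majorant (b : nat -> R) K A M :
  0 <= K -> 0 <= A -> 0 < M -> (forall k, 0 <= b k) ->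
  (forall k, b k <= K * (A * M ^+ k.+1 + \sum_(i < k) b i * b (k.-1 - i)%N)) ->
  exists B L, 0 < L /\ forall k, b k <= B * L ^+ k.+1.
Proof.
move=> K0 A0 M0 b0 Hb.
(* [t] is taken so that 4 K e <= 1 for e = K A / t, and [rho] so that the geometric sum of the (M
   rho)^(k+1) is at most 1 / t. *)
pose t := 1 + 4 * K ^+ 2 * A.
have t1 : 1 <= t by rewrite lerDl mulr_ge0// mulr_ge0// exprn_ge0.
have t0 : 0 < t by lra.
pose rho := (2 * M * t)^-1.
have rho0 : 0 < rho by rewrite invr_gt0 !mulr_gt0.
pose e := K * A / t.
have e0 : 0 <= e by rewrite !mulr_ge0// invr_ge0 ltW.
pose w k := b k * rho ^+ k.+1.
have w0 k : 0 <= w k by rewrite mulr_ge0// exprn_ge0// ltW.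
have Ke : 4 * K * e <= 1.
  rewrite /e mulrA ler_pdivrMr// mul1r /t; have : 4 * K * (K * A) = 4 * K ^+ 2 * A by ring.
  by move=> ->; lra.
have geo n : \sum_(k < n) (M * rho) ^+ k.+1 <= t^-1 * (1 - 2^-1 ^+ n).
  elim: n => [|n IH]; first by rewrite big_ord0 expr0 subrr mulr0.
  rewrite big_ord_recr /= (le_trans (lerD IH (lexx _)))//.
  have Mr : M * rho = 2^-1 * t^-1 by rewrite /rho; field; rewrite !gt_eqF.
  have : (M * rho) ^+ n.+1 <= t^-1 * 2^-1 ^+ n.+1.
    rewrite Mr exprMn mulrC; apply: ler_wpM2r; first by rewrite exprn_ge0// invr_ge0.
    by rewrite exprS ler_piMr ?exprn_ile1 ?invr_ge0 ?invf_le1// ltW.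
  by rewrite [2^-1 ^+ n.+1]exprS; lra.
have HS n : \sum_(k < n) w k <= 2 * e.
  elim: n => [|n IH]; first by rewrite big_ord0; lra.
  have S0 : 0 <= \sum_(k < n) w k by apply: sumr_ge0.
  have : \sum_(k < n.+1) w k <=
     K * A * (\sum_(k < n.+1) (M * rho) ^+ k.+1) + K * (\sum_(k < n) w k) ^+ 2.
    apply: (@le_trans _ _ (\sum_(k < n.+1) (K * A * (M * rho) ^+ k.+1 +
        K * \sum_(i < k) w i * w (k.-1 - i)%N))).
      apply: ler_sum => k _; rewrite /w.
      rewrite (le_trans (ler_wpM2r (exprn_ge0 _ (ltW rho0)) (Hb k)))//.
      rewrite mulrDr mulrDl exprMn -!mulrA lerD2l ler_wpM2l// mulr_suml.
      apply: ler_sum => i _; rewrite le_eqVlt; apply/orP; left; apply/eqP.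
      have ik := ltn_ord i.
      rewrite (_ : rho ^+ k.+1 = rho ^+ i.+1 * rho ^+ (k.-1 - i).+1); first by ring.
      by rewrite -exprD; congr (_ ^+ _); clear -ik; lia.
    rewrite big_split /= -mulr_sumr lerD2l -mulr_sumr ler_wpM2l//.
    rewrite big_ord_recl big_ord0 add0r /=.
    under eq_bigr do rewrite /bump /= add1n.
    rewrite (triangle_sum w w) expr2 mulr_suml; apply: ler_sum => i _.
    by rewrite ler_wpM2l// ler_sum_widen// leq_subr.
  move=> /le_trans; apply.
  have E1 : K * A * (\sum_(k < n.+1) (M * rho) ^+ k.+1) <= e.
    rewrite /e ler_wpM2l ?mulr_ge0//.
    rewrite (le_trans (geo _))// ler_piMr ?invr_ge0 ?(ltW t0)//.
  have E2 : K * (\sum_(k < n) w k) ^+ 2 <= K * (2 * e) ^+ 2.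
    by rewrite ler_wpM2l// lerXn2r ?nnegrE//; lra.
  have : K * (2 * e) ^+ 2 <= e.
    rewrite (_ : K * (2 * e) ^+ 2 = (4 * K * e) * e); last by ring.
    by rewrite ler_piMl.
  lra.
exists (2 * e), (rho^-1); split=> [|k]; first by rewrite invr_gt0.
rewrite exprVn ler_pdivlMr ?exprn_gt0// (le_trans _ (HS k.+1))//.
by rewrite big_ord_recr /= lerDr sumr_ge0.
Qed.

(** The coefficient of order k + 1 of G H = P reads g0 H_(k+1) + G_(k+1) h0 = r_k, where r_k
    involves only P and lower orders of G and H, so [hensel_step] determines the coefficients in
    turn. Its bounds give a quadratic recursion for their norms, which [convolution_majorant] turns
    into geometric growth. *)
Lemma hensel_coef m (P : nat -> {poly R[i]}) (g0 h0 : {poly R[i]}) (A M : R) :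
    g0 \is monic -> h0 \is monic -> (size g0 + size h0 = m.+2)%N ->
    coprimep g0 h0 -> P 0%N = g0 * h0 -> (forall k, size (P k.+1) <= m)%N ->
    0 <= A -> 0 < M -> (forall k, coef_norm m.+1 (P k) <= A * M ^+ k) ->
  exists G H : nat -> {poly R[i]},
    [/\ G 0%N = g0 /\ H 0%N = h0,
        forall k, (size (G k.+1) < size g0)%N /\ (size (H k.+1) < size h0)%N,
        forall k, \sum_(i < k.+1) G i * H (k - i)%N = P k &
        exists B L : R, 0 < L /\ forall k,
          coef_norm m.+1 (G k) <= B * L ^+ k /\ coef_norm m.+1 (H k) <= B * L ^+ k].
Proof.
move=> mg mh sgh cop P0 sP A0 M0 HP.
have [K K0 /choice[sol Hsol]] := hensel_step mg mh sgh cop.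
(* [rest] reads the new order from the length of the history: on k + 1 known pairs it is [r k]
   below. *)
pose rest (h : seq ({poly R[i]} * {poly R[i]})) :=
  P (size h) - \sum_(i < (size h).-1) (nth 0 h i.+1).1 * (nth 0 h ((size h).-1 - i)).2.
pose F h := if h is [::] then (g0, h0) else sol (rest h).
have [u Hu] := strong_recursion F.
pose r k := P k.+1 - \sum_(i < k) (u i.+1).1 * (u (k - i)%N).2.
have u0 : u 0%N = (g0, h0) by rewrite Hu.
have uS k : u k.+1 = sol (r k).
  rewrite Hu -[F _]/(sol (rest (mkseq u k.+1))) /rest size_mkseq; congr (sol (_ - _)).
  by apply: eq_bigr => i _; rewrite !nth_mkseq// ?ltnS ?leq_subr.
have sg : (0 < size g0)%N by rewrite size_poly_gt0 monic_neq0.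
have sh : (0 < size h0)%N by rewrite size_poly_gt0 monic_neq0.
have szr k : (size (r k) <= m)%N.
  elim/ltn_ind: k => k IH.
  rewrite (leq_trans (size_polyD _ _))// geq_max sP size_polyN.
  rewrite (leq_trans (size_sum _ _ _))//; apply/bigmax_leqP => i _.
  have [s1 _ _ _ _] := Hsol _ (IH i (ltn_ord i)); rewrite -uS in s1.
  have [|_ s2 _ _ _] := Hsol _ (IH (k - i).-1 _).
    by have := ltn_ord i; lia.
  rewrite -uS prednK ?subn_gt0// in s2.
  exact: size_polyM_le s1 (ltnW s2) sgh.
have conv k : \sum_(i < k.+1) (u i).1 * (u (k - i)%N).2 = P k.
  case: k => [|k]; first by rewrite big_ord1 u0.
  have [_ _ E _ _] := Hsol _ (szr k); rewrite -uS in E.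
  rewrite big_ord_recl subn0 big_ord_recr /= subSS subnn u0 /=.
  rewrite addrCA E /r addrC; under eq_bigr do rewrite /bump /= add1n subSS.
  by rewrite subrK.
(* [b] starts at order 1, so [b i * b (k.-1 - i)] pairs the orders i + 1 and k - i; for k = 0 the
   sum is empty and [k.-1] is harmless. *)
pose b k := coef_norm m.+1 (u k.+1).1 + coef_norm m.+1 (u k.+1).2.
have b0 k : 0 <= b k by rewrite addr_ge0 ?coef_norm_ge0.
have Hb k : b k <= 2 * K * (A * M ^+ k.+1 + \sum_(i < k) b i * b (k.-1 - i)%N).
  have [_ _ _ n1 n2] := Hsol _ (szr k); rewrite -!uS in n1 n2.
  have : coef_norm m.+1 (r k) <= A * M ^+ k.+1 + \sum_(i < k) b i * b (k.-1 - i)%N.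
    rewrite (le_trans (coef_normD _ _ _))// coef_normN lerD//.
    rewrite (le_trans (coef_norm_sum _ _))//; apply: ler_sum => i _.
    rewrite (le_trans (coef_normM _ _ _))// ler_pM ?coef_norm_ge0//.
      by rewrite lerDl coef_norm_ge0.
    have ik := ltn_ord i.
    rewrite /b (_ : (k.-1 - i).+1 = k - i)%N ?lerDr ?coef_norm_ge0//; clear -ik; lia.
  move=> /(ler_wpM2l K0); rewrite /b; lra.
have [B [L [L0 HB]]] := convolution_majorant (mulr_ge0 (ler0n _ 2) K0) A0 M0 b0 Hb.
exists (fun k => (u k).1), (fun k => (u k).2); split=> //.
- by rewrite u0.
- by move=> k; have [] := Hsol _ (szr k); rewrite -uS.
pose B' := Num.max B (coef_norm m.+1 g0 + coef_norm m.+1 h0).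
have BB' : B <= B' by rewrite le_max lexx.
exists B', L; split=> // -[|k].
  rewrite u0 expr0 mulr1 !le_max /=.
  by split; apply/orP; right; rewrite ?lerDl ?lerDr coef_norm_ge0.
have : b k <= B' * L ^+ k.+1.
  by rewrite (le_trans (HB k))// ler_wpM2r// exprn_ge0// ltW.
have := coef_norm_ge0 m.+1 (u k.+1).1; have := coef_norm_ge0 m.+1 (u k.+1).2.
rewrite /b; clear; split; lra.
Qed.

End Hensel.

(** * Hensel's lemma for polynomials with analytic coefficients *)

Section Analytic.
Variable R : realType.
Implicit Types (phi psi : R[i] -> R[i]) (p q : R[i] -> {poly R[i]}).

Definition analytic phi := exists c, expansion c phi.

Lemma analytic_cst a : analytic (fun=> a).
Proof. by eexists; apply: expansion_cst. Qed.

Lemma analytic_var : analytic id.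
Proof. by eexists; apply: expansion_var. Qed.

Lemma analyticD phi psi : analytic phi -> analytic psi -> analytic (fun s => phi s + psi s).
Proof. by move=> [c H] [d K]; eexists; apply: expansion_add H K. Qed.

Lemma analyticM phi psi : analytic phi -> analytic psi -> analytic (fun s => phi s * psi s).
Proof. by move=> [c H] [d K]; eexists; apply: expansion_mul H K. Qed.

Lemma analyticN phi : analytic phi -> analytic (fun s => - phi s).
Proof. by move=> [c H]; eexists; apply: expansion_opp H. Qed.

Lemma analyticX phi n : analytic phi -> analytic (fun s => phi s ^+ n).
Proof.
move=> H; elim: n => [|n IH]; first exact: analytic_cst.
by under eq_fun do rewrite exprS; apply: analyticM.
Qed.

Lemma analytic_sum n (F : nat -> R[i] -> R[i]) : (forall i, analytic (F i)) ->
  analytic (fun s => \sum_(i < n) F i s).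
Proof.
move=> H; elim: n => [|n IH].
  by under eq_fun do rewrite big_ord0; exact: analytic_cst.
by under eq_fun do rewrite big_ord_recr /=; apply: analyticD.
Qed.

Lemma analytic_comp phi k : (0 < k)%N -> analytic phi -> analytic (fun s => phi (s ^+ k)).
Proof. by move=> k0 [c H]; eexists; apply: expansion_comp k0 H. Qed.

Definition analytic_family p := forall i, analytic (fun s => (p s)`_i).

Lemma analytic_familyM p q : analytic_family p -> analytic_family q ->
  analytic_family (fun s => p s * q s).
Proof.
move=> Hp Hq i; under eq_fun do rewrite coefM.
by apply: (@analytic_sum _ (fun j s => (p s)`_j * (q s)`_(i - j))) => j; apply: analyticM.
Qed.

Lemma analytic_familyX p n : analytic_family p -> analytic_family (fun s => p s ^+ n).
Proof.
move=> H; elim: n => [|n IH] i; first exact: (analytic_cst (1 : {poly R[i]})`_i).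
by under eq_fun do rewrite exprS; apply: analytic_familyM.
Qed.

Lemma analytic_family_shift p m b : (forall s, size (p s) = m) -> analytic_family p ->
  analytic b -> analytic_family (fun s => p s \Po ('X - (b s)%:P)).
Proof.
move=> sp Hp Hb i; under eq_fun do rewrite coef_comp_poly sp.
apply: (@analytic_sum _ (fun j s => (p s)`_j * (('X - (b s)%:P) ^+ j)`_i)) => j.
apply: analyticM => //; apply: analytic_familyX => {}i.
under eq_fun do rewrite coefB coefX coefC.
apply: analyticD; [exact: analytic_cst|apply: analyticN].
by case: eqP => _; [|exact: analytic_cst].
Qed.

Lemma eq_expansion c d phi psi : c =1 d -> phi =1 psi -> expansion c phi -> expansion d psi.
Proof. by move=> /funext -> /funext ->. Qed.

Lemma expansion_sum n (c : nat -> nat -> R[i]) (F : nat -> R[i] -> R[i]) :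
  (forall i, expansion (c i) (F i)) ->
  expansion (fun k => \sum_(i < n) c i k) (fun s => \sum_(i < n) F i s).
Proof.
move=> H; elim: n => [|n IH].
  by apply: eq_expansion (expansion_cst 0) => k; rewrite big_ord0 ?mul0rn.
by apply: eq_expansion (expansion_add IH (H n)) => k; rewrite big_ord_recr.
Qed.

Lemma size_monic_poly m (b : nat -> R[i]) : size ('X^m + \poly_(i < m) b i) = m.+1.
Proof. by rewrite size_polyDl size_polyXn// ltnS size_poly. Qed.

Lemma monic_monic_poly m (b : nat -> R[i]) : 'X^m + \poly_(i < m) b i \is monic.
Proof. by rewrite monicE lead_coefDl ?lead_coefXn// size_polyXn ltnS size_poly. Qed.

(** The leading coefficient is set to 1 rather than summed, and the higher ones to 0, so that the
    family is monic of constant size for every s and not only near 0. *)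
Lemma family_exists m (G : nat -> {poly R[i]}) (B L : R) :
    G 0%N \is monic -> (size (G 0%N) <= m.+1)%N ->
    (forall k, (size (G k.+1) < size (G 0%N))%N) ->
    0 < L -> (forall k, coef_norm m.+1 (G k) <= B * L ^+ k) ->
  exists g, (forall s, g s \is monic /\ size (g s) = size (G 0%N)) /\
    forall j, expansion (fun k => (G k)`_j) (fun s => (g s)`_j).
Proof.
move=> mG sG szG L0 HB; set d := (size (G 0%N)).-1.
have sGd : size (G 0%N) = d.+1 by rewrite prednK// size_poly_gt0 monic_neq0.
have /choice[phi Hphi] : forall i, exists phi, (i < d)%N -> expansion (fun k => (G k)`_i) phi.
  move=> i; have [id|di] := ltnP i d; last by exists id.
  have [n|phi H] := @expansion_exists R (fun k => (G k)`_i) B L L0; last by exists phi.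
  by apply: le_trans (HB n); apply: coef_norm_coef; lia.
exists (fun s => 'X^d + \poly_(i < d) phi i s); split.
  by move=> s; rewrite monic_monic_poly size_monic_poly.
move=> j; have [jd|] := ltnP j d.
  apply: eq_expansion (Hphi j jd) => // s.
  by rewrite coefD coefXn coef_poly jd (ltn_eqF jd) add0r.
rewrite leq_eqVlt => /predU1P[<-|dj].
  apply: eq_expansion (expansion_cst 1) => [[|k]|s].
  - by move: mG; rewrite monicE lead_coefE -/d => /eqP ->.
  - by rewrite nth_default// -ltnS -sGd.
  - by rewrite coefD coefXn coef_poly eqxx ltnn addr0.
apply: eq_expansion (expansion_cst 0) => [k|s].
  rewrite mul0rn nth_default//; case: k => [|k]; first by rewrite sGd.
  by rewrite (leq_trans (ltnW (szG k)))// sGd.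
by rewrite coefD coefXn coef_poly (gtn_eqF dj) ltnNge (ltnW dj) addr0.
Qed.

(** [P k] gathers the coefficients of s^k; it has lower degree for k > 0 because the leading
    coefficient of p is the constant 1. The factors found coefficientwise converge, and their
    product is p because the expansions coincide. *)
Lemma hensel m p (c : nat -> nat -> R[i]) (g0 h0 : {poly R[i]}) :
    (forall s, p s \is monic /\ size (p s) = m.+1) ->
    (forall i, expansion (c i) (fun s => (p s)`_i)) ->
    g0 \is monic -> h0 \is monic -> (size g0 + size h0 = m.+2)%N ->
    coprimep g0 h0 -> (forall i, c i 0%N = (g0 * h0)`_i) ->
  exists g h, [/\ analytic_family g /\ analytic_family h,
    forall s, g s \is monic /\ size (g s) = size g0,
    forall s, h s \is monic /\ size (h s) = size h0 &
    \forall s \near punctured0, p s = g s * h s].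
Proof.
move=> mp Hc mg mh sgh cop c0.
pose P k := \poly_(i < m.+1) c i k.
have c_gt i k : (m < i)%N -> c i k = 0.
  move=> mi; rewrite (expansion_uniq _ (Hc i) (expansion_cst 0)) ?mul0rn//.
  by apply: nearW => s; rewrite nth_default//; have [_ ->] := mp s.
have P0 : P 0%N = g0 * h0.
  by apply/polyP => i; rewrite coef_poly -c0; case: ltnP => // /c_gt ->.
have sP k : (size (P k.+1) <= m)%N.
  apply/leq_sizeP => i mi; rewrite coef_poly; case: ltnP => // im.
  have -> : i = m by apply/eqP; rewrite eqn_leq mi -ltnS im.
  rewrite (expansion_uniq _ (Hc m) (expansion_cst 1)) ?mulr0n//.
  by apply: nearW => s; have [/monicP <- sp] := mp s; rewrite lead_coefE sp.
have /choice[A /choice[M HAM]] : forall i, exists A M : R,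
    [/\ 0 <= A, 0 < M & forall n, nrm (c i n) <= A * M ^+ n].
  move=> i; have [A [M [A0 _ M0 H]]] := expansion_large 0 1 (Hc i).
  exists (2 * A), M; split=> // [|n]; first by rewrite mulr_ge0.
  exact: dominated_coef H.
pose A1 := \sum_(i < m.+1) A i; pose M1 := \sum_(i < m.+1) M i.
have MM i : (i < m.+1)%N -> M i <= M1.
  move=> im; rewrite /M1 (bigD1 (Ordinal im))//= lerDl sumr_ge0// => j _.
  by have [_ /ltW] := HAM j.
have M10 : 0 < M1 by apply: lt_le_trans (MM 0%N _) => //; have [] := HAM 0%N.
have A10 : 0 <= A1 by apply: sumr_ge0 => i _; have [] := HAM i.
have HP k : coef_norm m.+1 (P k) <= A1 * M1 ^+ k.
  rewrite mulr_suml; apply: ler_sum => i _; rewrite coef_poly ltn_ord.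
  have [Ai Mi /(_ k)/le_trans] := HAM i; apply.
  by rewrite ler_wpM2l// lerXn2r ?nnegrE ?MM// ltW.
have [G [H [[G0 H0] sGH conv [B [L [L0 HB]]]]]] := hensel_coef mg mh sgh cop P0 sP A10 M10 HP.
have sg : (0 < size g0)%N by rewrite size_poly_gt0 monic_neq0.
have sh : (0 < size h0)%N by rewrite size_poly_gt0 monic_neq0.
have [||k|k|g [mgs Hg]] := @family_exists m G B L _ _ _ L0 _; rewrite ?G0//.
- lia.
- by have [] := sGH k.
- by have [] := HB k.
have [||k|k|h [mhs Hh]] := @family_exists m H B L _ _ _ L0 _; rewrite ?H0//.
- lia.
- by have [] := sGH k.
- by have [] := HB k.
rewrite G0 in mgs; rewrite H0 in mhs.
exists g, h; split=> //.
  by split=> j; eexists; [apply: Hg|apply: Hh].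
have near_coef j : \forall s \near punctured0, (p s)`_j = (g s * h s)`_j.
  have Hj := expansion_sum j.+1 (fun i => expansion_mul (Hg i) (Hh (j - i)%N)).
  apply: expansion_inj (Hc j) _; apply: eq_expansion Hj => [k|s]; last by rewrite coefM.
  rewrite exchange_big /=.
  have -> : c j k = (P k)`_j by rewrite coef_poly; case: ltnP => // /c_gt ->.
  by rewrite -conv coef_sum; apply: eq_bigr => l _; rewrite coefM.
(* Only finitely many coefficients have to be compared near 0; the others vanish for reasons of
   size. *)
have near_all : \forall s \near punctured0, forall i : 'I_m.+1, (p s)`_i = (g s * h s)`_i.
  by apply: filter_forall => i; apply: near_coef.
apply: filterS near_all => s Hs; apply/polyP => j.
have [jm|mj] := ltnP j m.+1; first exact: (Hs (Ordinal jm)).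
have [mps sps] := mp s; have [mgs' sgs] := mgs s; have [mhs' shs] := mhs s.
rewrite !nth_default// ?sps//.
by rewrite size_mul ?monic_neq0// sgs shs sgh.
Qed.

End Analytic.

(** * Newton polygon scaling and Puiseux's theorem *)

Section Puiseux.
Variable R : realType.
Implicit Types (phi psi : R[i] -> R[i]) (p q : R[i] -> {poly R[i]}).

Lemma coef_XsubC_exp (F : comNzRingType) (c : F) m :
  (('X - c%:P) ^+ m.+1)`_m = - (c *+ m.+1).
Proof.
have := @coefPn_prod_XsubC F (nseq m.+1 c).
by rewrite size_nseq !big_nseq !iter_mulr_1 iter_addr_0 => ->.
Qed.

Lemma monic_size1 (F : nzRingType) (r : {poly F}) : r \is monic -> size r = 1%N -> r = 1.
Proof.
by move=> /monicP + sr; rewrite lead_coefE sr [r]size1_polyC ?sr// coefC eqxx => ->.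
Qed.

(** Without its subleading term the polynomial cannot be a power of X - x with x nonzero, which is
    what [coprime_split] relies on. *)
Lemma tschirnhaus_coef m (p : {poly R[i]}) : p \is monic -> size p = m.+2 ->
  (p \Po ('X - (p`_m / m.+1%:R)%:P))`_m = 0.
Proof.
move=> mp sp; rewrite coef_comp_poly sp 2!big_ord_recr /= big1 => [|i _]; last first.
  by rewrite [X in _ * X]nth_default ?mulr0// size_exp_XsubC.
have -> : p`_m.+1 = 1 by move/monicP: mp; rewrite lead_coefE sp.
have -> : (('X - (p`_m / m.+1%:R)%:P) ^+ m)`_m = 1.
  move/monicP: (monic_exp m (monicXsubC (p`_m / m.+1%:R))).
  by rewrite lead_coefE size_exp_XsubC.
rewrite coef_XsubC_exp -[_ / _ *+ _]mulr_natr divfK ?pnatr_eq0//; ring.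
Qed.

(* e / q is the least slope ord (phi i) / (m - i), that is the slope of the edge
   of the Newton polygon issued from the vertex of 'X^m. *)
Lemma newton_scaling m (phi : nat -> R[i] -> R[i]) : (forall i, analytic (phi i)) ->
    ~ (forall i, (i < m)%N -> \forall s \near punctured0, phi i s = 0) ->
  exists (q e : nat) (b : nat -> R[i] -> R[i]) (c : nat -> nat -> R[i]),
    [/\ (0 < q)%N, forall i, expansion (c i) (b i),
      forall i, (i < m)%N -> \forall s \near punctured0,
        phi i (s ^+ q) = s ^+ (e * (m - i)) * b i s &
      exists2 i, (i < m)%N & c i 0%N != 0].
Proof.
move=> Hphi nz.
(* The boolean tells whether [phi i] is nonzero near 0; the number is then its order, and the rest
   is its unit part with an expansion. *)
have H i : exists kd : bool * nat * (R[i] -> R[i]) * (nat -> R[i]),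
    expansion kd.2 kd.1.2 /\
    if kd.1.1.1 then kd.2 0%N != 0 /\ forall s, s != 0 -> phi i s = s ^+ kd.1.1.2 * kd.1.2 s
    else \forall s \near punctured0, phi i s = 0.
  have [c Hc] := Hphi i; have [c0|[k [psi [ck _ Hpsi E]]]] := expansion_lead Hc.
    by exists (false, 0%N, phi i, c); split=> //=; apply: expansion0 Hc c0.
  by exists (true, k, psi, fun n => c (k + n)%N); rewrite /= addn0; split.
have /choice[d Hd] := H; clear H.
pose z i := (d i).1.1.1; pose k i := (d i).1.1.2; pose psi i := (d i).1.2.
have [i1 zi1] : exists i : 'I_m, z i.
  apply/not_existsP => zF; apply: nz => i im.
  by have [_] := Hd i; rewrite -/(z i); case: ifP => // zi; case: (zF (Ordinal im)).
pose ratio (i : 'I_m) : R := (k i)%:R / (m - i)%:R.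
case: (@Order.TotalTheory.arg_minP _ _ _ i1 (fun i => z i) ratio zi1) => i0 zi0 min.
have mi (i : 'I_m) : 0 < (m - i)%:R :> R by rewrite ltr0n subn_gt0.
have slope i : (i < m)%N -> z i -> (k i0 * (m - i) <= (m - i0) * k i)%N.
  move=> im zi; have := min (Ordinal im) zi.
  rewrite /ratio /= ler_pdivrMr// mulrAC ler_pdivlMr; last exact: (mi (Ordinal im)).
  by rewrite -!natrM ler_nat mulnC [X in (_ <= X)%N]mulnC [in X in (X <= _)%N]mulnC => ?; lia.
have q0 : (0 < m - i0)%N by rewrite subn_gt0.
(* After s -> s^q with q = m - i0, the order q k_i of [phi i] is at least e (m - i) for e = k_(i0).
   Equality at i0 makes the constant coefficient there nonzero. *)
have Hb i : exists bc : (R[i] -> R[i]) * (nat -> R[i]), expansion bc.2 bc.1 /\ ((i < m)%N ->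
    ((\forall s \near punctured0, phi i (s ^+ (m - i0)) = s ^+ (k i0 * (m - i)) * bc.1 s) /\
     (i = i0 :> nat -> bc.2 0%N != 0))).
  have [im|mi'] := ltnP i m; last first.
    by exists (fun=> 0, fun n => 0 *+ (n == 0%N)); split=> //; exact: expansion_cst.
  have [Hpsi] := Hd i; rewrite -/(z i); case: ifP => zi.
    move=> [d0 E].
    have [j Ej] : exists j, ((m - i0) * k i = k i0 * (m - i) + j)%N.
      by exists ((m - i0) * k i - k i0 * (m - i))%N; rewrite subnKC// slope.
    have [c Hc] : analytic (fun s => s ^+ j * psi i (s ^+ (m - i0))).
      apply: analyticM; first exact/analyticX/analytic_var.
      by apply: analytic_comp => //; eexists; apply: Hpsi.
    exists (fun s => s ^+ j * psi i (s ^+ (m - i0)), c); split=> // _; split.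
      exists 1 => // s /andP[]; rewrite nrm_gt0 => s0 _.
      by rewrite E ?expf_eq0 ?(negbTE s0) ?andbF// -exprM Ej exprD mulrA.
    move=> ii0; have j0 : j = 0%N by move: Ej; rewrite ii0; lia.
    rewrite /= -(_ : (d i).2 0%N = c 0%N)//.
    rewrite (expansion_uniq _ Hc (expansion_comp q0 Hpsi)) ?dvdn0 ?div0n//.
    by apply: nearW => s; rewrite j0 expr0 mul1r.
  move=> phi0; exists (fun=> 0, fun n => 0 *+ (n == 0%N)); split; first exact: expansion_cst.
  move=> _; split; last by move=> ii0; move: zi; rewrite ii0 zi0.
  by apply: filterS (punctured0_exp q0 phi0) => s ->; rewrite mulr0.
have /choice[bc Hbc] := Hb.
exists (m - i0)%N, (k i0), (fun i => (bc i).1), (fun i => (bc i).2); split=> //.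
- by move=> i; have [] := Hbc i.
- by move=> i im; have [_ /(_ im)[]] := Hbc i.
- by exists i0 => //; have [_ /(_ (ltn_ord i0))[_ ->]] := Hbc i0.
Qed.

(** One root x is split off with its full multiplicity. If it were the only root, the X^m
    coefficient -(m+1) x would vanish only for x = 0, which the last hypothesis excludes. *)
Lemma coprime_split m (r : {poly R[i]}) : r \is monic -> size r = m.+2 -> r`_m = 0 ->
    r != 'X^(m.+1) ->
  exists g h : {poly R[i]}, [/\ g \is monic /\ h \is monic, coprimep g h, r = g * h,
    (size g + size h = m.+3)%N & (1 < size g < m.+2)%N].
Proof.
move=> mr sr rm rX.
have /closed_rootP[x rx] : size r != 1%N by rewrite sr.
have [mu [h]] := multiplicity_XsubC r x; rewrite monic_neq0//= => hx E.
have mXx := monic_exp mu (monicXsubC x).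
have mh : h \is monic by rewrite -(monicMr h mXx) -E.
have szE : (mu.+1 + size h = m.+3)%N.
  have := sr; rewrite E size_mul ?monic_neq0// size_exp_XsubC addnS /= => H.
  by rewrite addSn addnC H.
exists (('X - x%:P) ^+ mu), h; split=> //.
- by rewrite coprimep_expl// coprimep_sym coprimep_XsubC.
- by rewrite mulrC.
- by rewrite size_exp_XsubC.
rewrite size_exp_XsubC; apply/andP; split.
  rewrite ltnS lt0n; apply/eqP => mu0.
  by move: E hx rx; rewrite mu0 expr0 mulr1 => -> /negbTE ->.
rewrite ltnNge; apply/negP => mum.
have h0 : (0 < size h)%N by rewrite size_poly_gt0 monic_neq0.
have [muE h1] : mu = m.+1 /\ size h = 1%N by split; lia.
have {}h1 := monic_size1 mh h1.
move: E; rewrite h1 mul1r muE => E.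
move: rm; rewrite E coef_XsubC_exp => /eqP; rewrite oppr_eq0 -mulr_natr mulf_eq0 pnatr_eq0 orbF.
by move=> /eqP x0; move: rX; rewrite E x0 subr0 eqxx.
Qed.

(** Induction on the degree. After the Tschirnhaus shift, either all lower coefficients vanish near
    0 and there is a single multiple root, or the Newton polygon scaling gives a family whose limit
    at s = 0 has two coprime factors of smaller degree. These lift by Hensel's lemma and split by
    induction. *)
Lemma puiseux m p : analytic_family p ->
    (forall s, p s \is monic /\ size (p s) = m.+1) ->
  exists (N : nat) (g : nat -> R[i] -> R[i]), [/\ (0 < N)%N, forall i, analytic (g i) &
    \forall s \near punctured0, forall w, (p (s ^+ N)).[w] = \prod_(i < m) (w - g i s)].
Proof.
elim/ltn_ind: m p => -[|m] IH p Hp mp.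
  exists 1%N, (fun _ _ => 0); split=> // [_|]; first exact: analytic_cst.
  apply: nearW => s w; rewrite big_ord0 expr1; have [mps sps] := mp s.
  by rewrite (monic_size1 mps sps) hornerC.
pose b s := (p s)`_m / m.+1%:R.
have Hb : analytic b by apply: analyticM => //; exact: analytic_cst.
pose p1 s := p s \Po ('X - (b s)%:P).
have Hp1 : analytic_family p1.
  by apply: (@analytic_family_shift _ _ m.+2) => // s; have [] := mp s.
have p1E s w : (p s).[w] = (p1 s).[w + b s].
  by rewrite horner_comp !hornerE addrK.
have mp1 s : p1 s \is monic /\ size (p1 s) = m.+2.
  have [mps sps] := mp s; split; last by rewrite size_comp_poly2 ?size_XsubC.
  by rewrite monicE lead_coef_comp ?size_XsubC// lead_coefXsubC expr1n mulr1 -monicE.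
have p1m s : (p1 s)`_m = 0 by have [mps sps] := mp s; apply: tschirnhaus_coef.
have p1_poly s : p1 s = 'X^(m.+1) + \poly_(i < m.+1) (p1 s)`_i.
  have [/monicP mps sps] := mp1 s; apply/polyP => i; rewrite coefD coefXn coef_poly.
  have [im|] := ltnP i m.+1; first by rewrite (ltn_eqF im) add0r.
  rewrite leq_eqVlt => /predU1P[<-|mi]; last by rewrite (gtn_eqF mi) addr0 nth_default ?sps.
  by rewrite eqxx addr0; move: mps; rewrite lead_coefE sps.
case: (pselect (forall i, (i < m.+1)%N -> \forall s \near punctured0, (p1 s)`_i = 0)).
  move=> p10; exists 1%N, (fun _ s => - b s); split=> // [_|]; first exact: analyticN.
  have H : \forall s \near punctured0, forall i : 'I_m.+1, (p1 s)`_i = 0.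
    by apply: filter_forall => i; apply: p10.
  apply: filterS H => s Hs w; rewrite expr1 p1E p1_poly.
  have -> : \poly_(i < m.+1) (p1 s)`_i = 0.
    by apply/polyP => i; rewrite coef_poly coef0; case: ltnP => // im; exact: (Hs (Ordinal im)).
  by rewrite addr0 hornerXn prodr_const card_ord opprK.
move=> /(newton_scaling Hp1)[q [e [a [c [q0 Ha Ea [i0 i0m ci0]]]]]].
pose p2 s := 'X^(m.+1) + \poly_(i < m.+1) a i s.
have mp2 s : p2 s \is monic /\ size (p2 s) = m.+2 by rewrite monic_monic_poly size_monic_poly.
have p2E : \forall s \near punctured0, forall w,
    (p1 (s ^+ q)).[s ^+ e * w] = s ^+ (e * m.+1) * (p2 s).[w].
  have H : \forall s \near punctured0, forall i : 'I_m.+1,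
      (p1 (s ^+ q))`_i = s ^+ (e * (m.+1 - i)) * a i s.
    by apply: filter_forall => i; apply: Ea.
  apply: filterS H => s Hs w; rewrite p1_poly /p2 !hornerE !horner_poly exprMn mulrDr.
  rewrite {1}exprM; congr (_ + _); rewrite mulr_sumr; apply: eq_bigr => i _.
  have -> : s ^+ (e * m.+1) = s ^+ (e * (m.+1 - i)) * (s ^+ e) ^+ i.
    by rewrite -exprM -exprD -mulnDr subnK// ltnW.
  by rewrite Hs exprMn; ring.
pose c' i := if (i < m.+1)%N then c i else fun n => (i == m.+1)%:R *+ (n == 0%N).
have Hc' i : expansion (c' i) (fun s => (p2 s)`_i).
  rewrite /c'; case: ltnP => im.
    apply: eq_expansion (Ha i) => // s.
    by rewrite coefD coefXn coef_poly im (ltn_eqF im) add0r.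
  apply: eq_expansion (expansion_cst _) => // s.
  by rewrite coefD coefXn coef_poly ltnNge im addr0.
pose r := 'X^(m.+1) + \poly_(i < m.+1) c i 0%N.
have mr : r \is monic := monic_monic_poly _ _.
have sr : size r = m.+2 := size_monic_poly _ _.
have c'r i : c' i 0%N = r`_i.
  rewrite /c' coefD coefXn coef_poly; case: ltnP => im; first by rewrite (ltn_eqF im) add0r.
  by rewrite addr0 mulr1n.
(* The vanishing of the X^m coefficient survives the division by a power of s and so passes to the
   limit polynomial [r]. *)
have rm : r`_m = 0.
  rewrite -c'r (expansion_uniq _ (Hc' m) (expansion_cst 0)) ?mul0rn//.
  have : \forall s \near punctured0, s != 0 /\ (p1 (s ^+ q))`_m = s ^+ (e * (m.+1 - m)) * a m s.
    by apply: filterI; [exact: punctured0_neq0|exact: Ea].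
  apply: filterS => s [s0 /eqP]; rewrite p1m eq_sym mulf_eq0 expf_eq0 (negbTE s0) andbF /=.
  by rewrite coefD coefXn coef_poly ltnSn (ltn_eqF (ltnSn _)) add0r => /eqP.
have rX : r != 'X^(m.+1).
  apply/eqP => E; move: ci0; have : r`_i0 = 0 by rewrite E coefXn (ltn_eqF i0m).
  by rewrite -c'r /c' i0m => ->; rewrite eqxx.
have [g0 [h0 [[mg0 mh0] cop E sgh sg]]] := coprime_split mr sr rm rX.
have [i|g [h [[Hg Hh] mg mh gh]]] := hensel mp2 Hc' mg0 mh0 sgh cop.
  by rewrite c'r E.
have sg0 : size g0 = (size g0).-1.+1 by rewrite prednK//; lia.
have sh0 : size h0 = (size h0).-1.+1 by rewrite prednK//; lia.
have [|//|s|N1 [g1 [N10 Hg1 Eg]]] := IH (size g0).-1 _ g; first by lia.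
  by rewrite -sg0.
have [|//|s|N2 [h1 [N20 Hh1 Eh]]] := IH (size h0).-1 _ h; first by lia.
  by rewrite -sh0.
(* The two factors are uniformized by s^N1 and s^N2; substituting s^N2 and s^N1 respectively in
   their roots brings both to s^(N1 N2). *)
pose root i s := if (i < (size g0).-1)%N then g1 i (s ^+ N2)
                 else h1 (i - (size g0).-1)%N (s ^+ N1).
have Hroot i : analytic (root i).
  by rewrite /root; case: ltnP => _; apply: analytic_comp.
pose N := (N1 * N2)%N.
have N0 : (0 < N)%N by rewrite muln_gt0 N10.
exists (q * N)%N, (fun i s => s ^+ (N * e) * root i s - b (s ^+ (q * N))); split.
- by rewrite muln_gt0 q0.
- move=> i; apply: analyticD; first by apply: analyticM => //; apply/analyticX/analytic_var.
  by apply/analyticN/analytic_comp => //; rewrite muln_gt0 q0.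
near=> s => w.
have s0 : s != 0 by near: s; exact: punctured0_neq0.
have Ep2 : forall w, (p1 ((s ^+ N) ^+ q)).[(s ^+ N) ^+ e * w] =
    (s ^+ N) ^+ (e * m.+1) * (p2 (s ^+ N)).[w].
  by near: s; exact: (punctured0_exp N0 p2E).
have Egh : p2 (s ^+ N) = g (s ^+ N) * h (s ^+ N).
  by near: s; exact: (punctured0_exp N0 gh).
have Eg' : forall w, (g ((s ^+ N2) ^+ N1)).[w] = \prod_(i < (size g0).-1) (w - g1 i (s ^+ N2)).
  by near: s; exact: (punctured0_exp N20 Eg).
have Eh' : forall w, (h ((s ^+ N1) ^+ N2)).[w] = \prod_(i < (size h0).-1) (w - h1 i (s ^+ N1)).
  by near: s; exact: (punctured0_exp N10 Eh).
have p2_prod v : (p2 (s ^+ N)).[v] = \prod_(i < m.+1) (v - root i s).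
  rewrite Egh hornerM {1}(_ : s ^+ N = (s ^+ N2) ^+ N1) ?Eg'; last by rewrite -exprM mulnC.
  rewrite (_ : s ^+ N = (s ^+ N1) ^+ N2) ?Eh'; last by rewrite -exprM.
  have -> : m.+1 = ((size g0).-1 + (size h0).-1)%N by clear -sgh sg0 sh0; lia.
  rewrite big_split_ord /=; congr (_ * _); apply: eq_bigr => i _.
    by rewrite /root ltn_ord.
  by rewrite /root ltnNge leq_addr addKn.
have sN : s ^+ (N * e) != 0 by rewrite expf_eq0 (negbTE s0) andbF.
pose v := (w + b (s ^+ (q * N))) / s ^+ (N * e).
have wE : w + b (s ^+ (q * N)) = (s ^+ N) ^+ e * v by rewrite /v -exprM mulrC divfK.
rewrite p1E wE mulnC exprM Ep2 p2_prod -exprM mulnA exprM.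
rewrite -[X in _ ^+ X]card_ord -prodr_const -big_split /=; apply: eq_bigr => i _.
by rewrite mulrBr /v mulrC divfK// -exprM [(N * q)%N]mulnC; ring.
Unshelve. all: by end_near. Qed.

End Puiseux.

(** * Meromorphic germs and their Euler derivatives *)

Section EulerDerivative.
Variable R : realType.
Implicit Types (phi psi : R[i] -> R[i]).

(* [psi] is s d/ds [phi]; unlike d/ds, this is dominated by [phi] near 0. *)
Definition euler phi psi :=
  exists c, expansion c phi /\ expansion (fun n => n%:R * c n) psi.

Lemma euler_cst a : euler (fun=> a) (fun=> 0).
Proof.
exists (fun n => a *+ (n == 0%N)); split; first exact: expansion_cst.
apply: eq_expansion (expansion_cst 0) => // -[|n]; first by rewrite mul0r mul0rn.
by rewrite !mulr0n mulr0.
Qed.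

Lemma euler_var : euler id id.
Proof.
exists (fun n => (n == 1%N)%:R); split; first exact: expansion_var.
apply: eq_expansion (@expansion_var R) => // -[|[|n]] //=; first by rewrite mulr0.
  by rewrite mulr1.
by rewrite mulr0.
Qed.

Lemma eulerD phi phi' psi psi' : euler phi phi' -> euler psi psi' ->
  euler (fun s => phi s + psi s) (fun s => phi' s + psi' s).
Proof.
move=> [c [Hc Hc']] [d [Hd Hd']]; exists (fun n => c n + d n).
split; first exact: expansion_add.
by apply: eq_expansion (expansion_add Hc' Hd') => // n; rewrite mulrDr.
Qed.

Lemma eulerM phi phi' psi psi' : euler phi phi' -> euler psi psi' ->
  euler (fun s => phi s * psi s) (fun s => phi' s * psi s + phi s * psi' s).
Proof.
move=> [c [Hc Hc']] [d [Hd Hd']].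
exists (fun n => \sum_(i < n.+1) c i * d (n - i)%N); split; first exact: expansion_mul.
apply: eq_expansion (expansion_add (expansion_mul Hc' Hd) (expansion_mul Hc Hd')) => // n.
rewrite -big_split mulr_sumr; apply: eq_bigr => i _ /=.
by rewrite natrB -1?ltnS//; ring.
Qed.

Lemma euler_exp k : euler (fun s => s ^+ k) (fun s => k%:R * s ^+ k).
Proof.
elim: k => [|k IH].
  have [c [H H']] := euler_cst 1; exists c; split; first by [].
  by apply: eq_expansion H' => // s; rewrite mul0r.
have [c [H H']] := eulerM euler_var IH; exists c; split.
  by apply: eq_expansion H => // s; rewrite exprS.
by apply: eq_expansion H' => // s; rewrite exprS -natr1; ring.
Qed.

(** The factor n in the coefficients is absorbed by 2^n, that is, by doubling [M]. *)
Lemma euler_exists phi : analytic phi -> exists psi, euler phi psi.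
Proof.
move=> [c Hc]; have [A [M [A0 _ M0 H]]] := expansion_large 0 0 Hc.
have [|n|psi Hpsi] := @expansion_exists R (fun n => n%:R * c n) (2 * A) (2 * M).
- by rewrite mulr_gt0.
- rewrite nrmM nrm_nat exprMn mulrCA ler_pM ?nrm_ge0//.
    by rewrite -natrX ler_nat ltnW// ltn_expl.
  exact: dominated_coef H.
by exists psi, c.
Qed.

Lemma expansion_bounded c phi : expansion c phi ->
  exists2 A, 0 < A & \forall s \near punctured0, nrm (phi s) <= A.
Proof.
move=> /(expansion_large 1 0) [A [M [A0 _ M0 H]]]; exists A; first by lra.
exists M^-1; first by rewrite invr_gt0.
move=> s; rewrite nrm_gt0 => /andP[s0 sM].
have := H s s0 _ 0%N; rewrite big_ord0 subr0 expr0 mulr1; apply.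
by rewrite mulrC -ler_pdivlMr// mul1r ltW.
Qed.

Lemma analytic_bounded phi : analytic phi ->
  exists2 A, 0 < A & \forall s \near punctured0, nrm (phi s) <= A.
Proof. by move=> [c]; apply: expansion_bounded. Qed.

(** The operator s d/ds keeps zero coefficients zero, hence does not lower the order, whereas [phi]
    is s^k times a germ bounded away from 0. *)
Lemma euler_bound phi psi : euler phi psi ->
  exists2 C, 0 < C & \forall s \near punctured0, nrm (psi s) <= C * nrm (phi s).
Proof.
move=> [c [Hc Hc']]; have [c0|[k [chi [ck cz Hchi E]]]] := expansion_lead Hc.
  exists 1 => //; have := expansion0 Hc' _ => /(_ (fun n => _)) H.
  have {}H : \forall s \near punctured0, psi s = 0.
    by apply: expansion0 Hc' _ => n; rewrite c0 mulr0.
  by apply: filterS H => s ->; rewrite nrm0 mul1r nrm_ge0.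
have [|chi' [Hchi' E']] := @expansion_shift _ _ _ k Hc'.
  by move=> n nk; rewrite cz ?mulr0.
have [A A0 HA] := expansion_bounded Hchi'.
have ck0 : 0 < nrm (c k) by rewrite nrm_gt0.
have := expansion_unit Hchi; rewrite addn0 => /(_ ck) Hu.
exists (2 * A / nrm (c k)); first by rewrite divr_gt0// mulr_gt0.
near=> s.
have s0 : s != 0 by near: s; exact: punctured0_neq0.
have sk : 0 <= nrm s ^+ k by rewrite exprn_ge0// nrm_ge0.
rewrite E// E'// !nrmM nrmX mulrCA ler_wpM2l//.
have H1 : nrm (chi' s) <= A by near: s.
have H2 : nrm (c k) / 2 <= nrm (chi s) by near: s; apply: filterS Hu => ? /andP[].
rewrite (le_trans H1)// mulrAC ler_pdivlMr//.
by have := ler_wpM2l (ltW A0) H2; lra.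
Unshelve. all: by end_near. Qed.

(* [phi] is meromorphic at 0 and [phi'] is s d/ds [phi]. *)
Definition mero phi phi' := exists k psi psi', [/\ euler psi psi',
  \forall s \near punctured0, phi s = psi s / s ^+ k &
  \forall s \near punctured0, phi' s = (psi' s - k%:R * psi s) / s ^+ k].

Lemma mero_eq phi phi' psi psi' :
  (\forall s \near punctured0, phi s = psi s) ->
  (\forall s \near punctured0, phi' s = psi' s) -> mero phi phi' -> mero psi psi'.
Proof.
move=> E E' [k [chi [chi' [H H1 H2]]]]; exists k, chi, chi'; split=> //.
  by apply: filterS2 E H1 => s <- <-.
by apply: filterS2 E' H2 => s <- <-.
Qed.

Lemma mero_euler phi phi' : euler phi phi' -> mero phi phi'.
Proof.
by move=> H; exists 0%N, phi, phi'; split=> //; apply: nearW => s;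
  rewrite ?mul0r ?subr0 expr0 divr1.
Qed.

Lemma mero_pole N : mero (fun s => s ^- N) (fun s => - N%:R * s ^- N).
Proof.
exists N, (fun=> 1), (fun=> 0); split; first exact: euler_cst.
  by apply: nearW => s; rewrite div1r.
by apply: nearW => s; rewrite mulr1 sub0r.
Qed.

Lemma meroD phi phi' psi psi' : mero phi phi' -> mero psi psi' ->
  mero (fun s => phi s + psi s) (fun s => phi' s + psi' s).
Proof.
move=> [k [a [a' [Ha E1 E1']]]] [l [b [b' [Hb E2 E2']]]].
exists (k + l)%N; eexists; eexists; split.
- exact: eulerD (eulerM (euler_exp l) Ha) (eulerM (euler_exp k) Hb).
- near=> s; have s0 : s != 0 by near: s; exact: punctured0_neq0.
  have -> : phi s = a s / s ^+ k by near: s.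
  have -> : psi s = b s / s ^+ l by near: s.
  by rewrite exprD; field; rewrite !expf_eq0 (negbTE s0) !andbF.
near=> s; have s0 : s != 0 by near: s; exact: punctured0_neq0.
have -> : phi' s = (a' s - k%:R * a s) / s ^+ k by near: s.
have -> : psi' s = (b' s - l%:R * b s) / s ^+ l by near: s.
by rewrite exprD natrD; field; rewrite !expf_eq0 (negbTE s0) !andbF.
Unshelve. all: by end_near. Qed.

Lemma meroM phi phi' psi psi' : mero phi phi' -> mero psi psi' ->
  mero (fun s => phi s * psi s) (fun s => phi' s * psi s + phi s * psi' s).
Proof.
move=> [k [a [a' [Ha E1 E1']]]] [l [b [b' [Hb E2 E2']]]].
exists (k + l)%N; eexists; eexists; split; first exact: eulerM Ha Hb.
  near=> s; have s0 : s != 0 by near: s; exact: punctured0_neq0.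
  have -> : phi s = a s / s ^+ k by near: s.
  have -> : psi s = b s / s ^+ l by near: s.
  by rewrite exprD; field; rewrite !expf_eq0 (negbTE s0) !andbF.
near=> s; have s0 : s != 0 by near: s; exact: punctured0_neq0.
have -> : phi s = a s / s ^+ k by near: s.
have -> : psi s = b s / s ^+ l by near: s.
have -> : phi' s = (a' s - k%:R * a s) / s ^+ k by near: s.
have -> : psi' s = (b' s - l%:R * b s) / s ^+ l by near: s.
by rewrite exprD natrD; field; rewrite !expf_eq0 (negbTE s0) !andbF.
Unshelve. all: by end_near. Qed.

Lemma mero_branch N g : analytic g ->
  exists root', mero (fun s => s ^- N * g s) root'.
Proof.
move=> Hg; have [h Hh] := euler_exists Hg.
by eexists; apply: meroM (mero_pole N) (mero_euler Hh).
Qed.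

Lemma mero_bound phi phi' : mero phi phi' ->
  exists2 C, 0 < C & \forall s \near punctured0, nrm (phi' s) <= C * nrm (phi s).
Proof.
move=> [k [a [a' [Ha E E']]]]; have [C C0 HC] := euler_bound Ha.
exists (C + k%:R); first by rewrite ltr_wpDr.
near=> s.
have -> : phi s = a s / s ^+ k by near: s.
have -> : phi' s = (a' s - k%:R * a s) / s ^+ k by near: s.
rewrite !nrmM mulrA ler_wpM2r ?nrm_ge0// (le_trans (nrmB _ _))//.
rewrite mulrDl nrmM nrm_nat lerD2r.
by near: s.
Unshelve. all: by end_near. Qed.

Lemma mero_order phi phi' : mero phi phi' ->
  (\forall s \near punctured0, phi s = 0) \/
  exists (k : int) (A B : R), [/\ 0 < A, 0 < B &
    \forall s \near punctured0, A * nrm s ^ k <= nrm (phi s) <= B * nrm s ^ k].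
Proof.
move=> [k [a [a' [[c [Hc _]] E _]]]].
have [c0|[j [chi [cj cz Hchi E']]]] := expansion_lead Hc.
  left; apply: filterS2 E (expansion0 Hc c0) => s -> ->; exact: mul0r.
right; exists (j%:Z - k%:Z), (nrm (c j) / 2), (2 * nrm (c j)).
have cj0 : 0 < nrm (c j) by rewrite nrm_gt0.
split; [by rewrite divr_gt0|by rewrite mulr_gt0|].
have := expansion_unit Hchi; rewrite addn0 => /(_ cj) Hu.
near=> s; have s0 : s != 0 by near: s; exact: punctured0_neq0.
have s_gt0 : 0 < nrm s by rewrite nrm_gt0.
have -> : phi s = a s / s ^+ k by near: s.
rewrite E'// !nrmM nrmV !nrmX.
have -> : nrm s ^ (j%:Z - k%:Z) = nrm s ^+ j / nrm s ^+ k.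
  by rewrite expfzDr ?gt_eqF// exprnN exprnP.
have q0 : 0 < nrm s ^+ j / nrm s ^+ k by rewrite divr_gt0// exprn_gt0.
have -> : nrm s ^+ j * nrm (chi s) / nrm s ^+ k = nrm (chi s) * (nrm s ^+ j / nrm s ^+ k) by ring.
by rewrite !ler_pM2r//; near: s.
Unshelve. all: by end_near. Qed.

(* A bounded Euler derivative forces a finite limit, since the pole terms
   s^n with n < 0 survive in s d/ds. *)
Lemma mero_limit phi phi' B : mero phi phi' ->
  (\forall s \near punctured0, nrm (phi' s) <= B) ->
  exists l C, 0 < C /\ \forall s \near punctured0, nrm (phi s - l) <= C * nrm s.
Proof.
move=> [k [a [a' [[c [Hc Hc']] E E']]]] HB.
have Hd : expansion (fun n => (n%:R - k%:R) * c n) (fun s => a' s - k%:R * a s).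
  have := expansion_add Hc' (expansion_opp (expansion_mul (expansion_cst k%:R) Hc)).
  apply: eq_expansion => // n; rewrite big_ord_recl /= subn0 big1 ?addr0 ?mulr1n.
    by rewrite mulrBl.
  by move=> i _; rewrite mulr0n mul0r.
have cz n : (n < k)%N -> c n = 0.
  move=> nk; have [d0|[j [chi [dj dz Hchi Ej]]]] := expansion_lead Hd.
    have /eqP := d0 n; rewrite mulf_eq0 subr_eq0 eqr_nat (ltn_eqF nk).
    by move=> /eqP.
  have [nj|jn] := ltnP n j.
    have /eqP := dz n nj; rewrite mulf_eq0 subr_eq0 eqr_nat (ltn_eqF nk).
    by move=> /eqP.
  (* Here [phi'] is s^(j - k) times a germ bounded away from 0, with j < k, against the bound
     [HB]. *)
  exfalso; have jk : (j < k)%N by rewrite (leq_ltn_trans jn).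
  set dj' := (j%:R - k%:R) * c j in dj.
  have := expansion_unit Hchi; rewrite addn0 -/dj' => /(_ dj) Hu.
  have dj0 : 0 < nrm dj' by rewrite nrm_gt0.
  pose B' := Num.max B 1.
  have B'0 : 0 < B' by rewrite lt_max ltr01 orbT.
  near (@punctured0 R) => s; have s0 : s != 0 by near: s; exact: punctured0_neq0.
  have s_gt0 : 0 < nrm s by rewrite nrm_gt0.
  have s_small : nrm s < Num.min 1 (nrm dj' / (2 * B')).
    by near: s; apply: punctured0_lt; rewrite lt_min ltr01 divr_gt0// mulr_gt0.
  move: s_small; rewrite lt_min ltr_pdivlMr ?mulr_gt0// => /andP[s1 sd].
  have H1 : nrm dj' / 2 <= nrm (chi s) by near: s; apply: filterS Hu => ? /andP[].
  have H2 : nrm (phi' s) <= B' by rewrite le_max; apply/orP; left; near: s.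
  have : nrm (phi' s) = nrm (chi s) / nrm s ^+ (k - j).
    have -> : phi' s = (a' s - k%:R * a s) / s ^+ k by near: s.
    rewrite Ej// -[in s ^+ k](subnKC (ltnW jk)) exprD -nrmX -nrmV -nrmM; congr nrm.
    by field; rewrite !expf_eq0 (negbTE s0) !andbF.
  move=> E2; move: H2; rewrite E2 ler_pdivrMr ?exprn_gt0//.
  have : nrm s ^+ (k - j) <= nrm s.
    by rewrite -{2}[nrm s]expr1 ler_wiXn2l ?subn_gt0// ltW.
  by move=> /(ler_wpM2l (ltW B'0)); lra.
have [chi [Hchi Ek]] := expansion_shift Hc cz.
have [A [M [A0 _ M0 H]]] := expansion_large 1 0 Hchi.
exists (c k), (A * M); split; first by rewrite mulr_gt0//; lra.
near=> s; have s0 : s != 0 by near: s; exact: punctured0_neq0.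
have -> : phi s = chi s.
  have -> : phi s = a s / s ^+ k by near: s.
  by rewrite Ek// mulrC mulKf// expf_eq0 (negbTE s0) andbF.
have := H s s0 _ 1%N; rewrite big_ord1 addn0 expr0 mulr1 expr1 mulrA; apply.
rewrite mulrC -ler_pdivlMr// mul1r ltW//.
by near: s; apply: punctured0_lt; rewrite invr_gt0.
Unshelve. all: by end_near. Qed.

End EulerDerivative.

(** * The estimate near the polar curve *)

Section Bivariate.
Variable R : realType.
Implicit Types (f : {poly {poly R[i]}}) (x y h : R[i]).

Definition ev f x y : R[i] := f.[y%:P].[x].

Lemma partial_x_coef f i : (partial_x f)`_i = (f`_i)^`().
Proof. by rewrite coef_map_id0// deriv0. Qed.

Lemma partial_x_nderivn f k : partial_x f^`N(k) = (partial_x f)^`N(k).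
Proof.
by apply/polyP => i; rewrite partial_x_coef !coef_nderivn partial_x_coef derivMn.
Qed.

Lemma partial_y_nderivn f k : partial_y f^`N(k) = (partial_y f)^`N(k).
Proof.
apply/polyP => i; rewrite coef_deriv !coef_nderivn coef_deriv -!mulrnA addnS.
by rewrite -[(k + i)%N]/((k + i).+1.-1) mul_bin_down subSn ?leq_addr// addKn mulnC.
Qed.

Lemma nderivn_partial_y f l : (partial_y f)^`N(l) = f^`N(l.+1) *+ l.+1.
Proof.
apply/polyP => i; rewrite coefMn !coef_nderivn coef_deriv -!mulrnA addSn.
by rewrite -[(l + i)%N]/((l + i).+1.-1) mul_bin_diag mulnC.
Qed.

Lemma size_partial_x f : (size (partial_x f) <= size f)%N.
Proof. exact: size_poly. Qed.

Lemma size_partial_y f : (size (partial_y f) <= size f)%N.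
Proof. by rewrite (leq_trans (size_poly _ _))// leq_pred. Qed.

Lemma ev_taylor f d x y h : (size f <= d)%N ->
  ev f x (y + h) = \sum_(k < d) ev f^`N(k) x y * h ^+ k.
Proof.
move=> fd; rewrite /ev polyCD (nderiv_taylor_wide (mulrC _ _) fd) horner_sum.
by apply: eq_bigr => k _; rewrite hornerM -polyC_exp hornerC.
Qed.

Lemma mero_horner (a : {poly R[i]}) phi phi' : mero phi phi' ->
  mero (fun s => a.[phi s]) (fun s => a^`().[phi s] * phi' s).
Proof.
move=> H; elim/poly_ind: a => [|a c IH].
  apply: mero_eq (mero_euler (euler_cst 0)); apply: nearW => s; first by rewrite horner0.
  by rewrite deriv0 horner0 mul0r.
apply: mero_eq (meroD (meroM IH H) (mero_euler (euler_cst c))); apply: nearW => s.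
  by rewrite hornerMXaddC.
by rewrite derivMXaddC hornerD hornerMX; ring.
Qed.

Lemma ev_MXaddC f (a : {poly R[i]}) x y : ev (f * 'X + a%:P) x y = ev f x y * y + a.[x].
Proof. by rewrite /ev hornerMXaddC hornerD hornerM hornerC. Qed.

(** The chain rule for the Euler derivative, proved along Horner's scheme in y. *)
Lemma mero_ev f X X' Y Y' : mero X X' -> mero Y Y' ->
  mero (fun s => ev f (X s) (Y s))
    (fun s => ev (partial_x f) (X s) (Y s) * X' s + ev (partial_y f) (X s) (Y s) * Y' s).
Proof.
move=> HX HY; elim/poly_ind: f => [|f a IH].
  apply: mero_eq (mero_euler (euler_cst 0)); apply: nearW => s.
    by rewrite /ev !horner0.
  rewrite /ev /partial_y deriv0 (_ : partial_x 0 = 0) ?horner0 ?mul0r ?addr0//.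
  by apply/polyP => i; rewrite partial_x_coef !coef0 deriv0.
apply: mero_eq (meroD (meroM IH HY) (mero_horner a HX)); apply: nearW => s.
  by rewrite ev_MXaddC.
have -> : partial_x (f * 'X + a%:P) = partial_x f * 'X + (a^`())%:P.
  apply/polyP => i; rewrite partial_x_coef !coefD !coefMX !coefC derivD.
  by rewrite partial_x_coef; case: eqP; rewrite ?deriv0.
have -> : ev (partial_y (f * 'X + a%:P)) (X s) (Y s) =
    ev f (X s) (Y s) + ev (partial_y f) (X s) (Y s) * Y s.
  by rewrite /ev /partial_y derivMXaddC hornerD hornerMX hornerD hornerM hornerC.
by rewrite ev_MXaddC; ring.
Qed.

Lemma poly_horner_inj (p q : {poly R[i]}) : (forall x, p.[x] = q.[x]) -> p = q.
Proof.
move=> E; apply/eqP; rewrite -subr_eq0; apply/eqP.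
apply: (@roots_geq_poly_eq0 _ _ [seq i%:R | i <- iota 0 (size (p - q))]).
- by apply/allP => x _; rewrite rootE hornerD hornerN E subrr.
- by rewrite map_inj_uniq ?iota_uniq// => i j /eqP; rewrite eqr_nat => /eqP.
- by rewrite size_map size_iota.
Qed.

(** The coefficients of the product of the X - d_i are bounded in modulus by those of the product of
    the X + |d_i|, whose value at r is the right-hand side. *)
Lemma coef_prod_XsubC_bound m (d : nat -> R[i]) (r : R) D : 0 <= r ->
  \sum_(l < D) nrm (\prod_(i < m) ('X - (d i)%:P))`_l * r ^+ l <=
  \prod_(i < m) (r + nrm (d i)).
Proof.
move=> r0; elim: m D => [|m IH] D.
  rewrite !big_ord0; case: D => [|D]; first by rewrite big_ord0.
  rewrite big_ord_recl coef1 nrm1 expr0 mulr1 big1 ?addr0// => i _.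
  by rewrite coef1 mulr0n nrm0 mul0r.
rewrite !big_ord_recr /=; set q := \prod_(i < m) _.
have P0 : 0 <= \prod_(i < m) (r + nrm (d i)).
  by apply: prodr_ge0 => i _; rewrite addr_ge0 ?nrm_ge0.
apply: (@le_trans _ _ (\sum_(l < D) nrm (q * 'X)`_l * r ^+ l +
                       nrm (d m) * \sum_(l < D) nrm q`_l * r ^+ l)).
  rewrite mulr_sumr -big_split; apply: ler_sum => l _ /=.
  rewrite mulrBr coefB coefMC mulrA -mulrDl ler_wpM2r ?exprn_ge0//.
  by rewrite (le_trans (nrmB _ _))// nrmM [X in _ + X]mulrC.
rewrite mulrDr lerD//; last by rewrite [X in _ <= X]mulrC ler_wpM2l ?nrm_ge0.
case: D => [|D]; first by rewrite big_ord0 mulr_ge0.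
rewrite big_ord_recl coefMX nrm0 mul0r add0r.
rewrite (_ : \sum_(i < D) _ = (\sum_(l < D) nrm q`_l * r ^+ l) * r) ?ler_wpM2r//.
by rewrite mulr_suml; apply: eq_bigr => l _; rewrite coefMX exprSr mulrA.
Qed.

End Bivariate.

Section PolarEstimate.
Variable R : realType.
Variables (f : {poly {poly R[i]}}) (N m : nat) (u : R[i]) (g : nat -> R[i] -> R[i]).
Hypothesis N0 : (0 < N)%N.
Hypothesis Hg : forall i, analytic (g i).
Hypothesis splitH : \forall s \near punctured0, forall y,
  ev (partial_y f) (s ^- N) y = u * \prod_(i < m) (y - s ^- N * g i s).

Local Notation root j s := (s ^- N * g j s).

(** The Taylor coefficients of f_y at the root r are the coefficients of u times the product of the
    X - (r_i - r), and they exceed those of f, one order higher, by the factor l + 1 >= 1. As r is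
    the nearest root, |y - r| + |r_i - r| <= 3 |y - r_i|, whence 3^m. *)
Lemma taylor_bound s (j : 'I_m) y D :
  (forall y, ev (partial_y f) (s ^- N) y = u * \prod_(i < m) (y - root i s)) ->
  (forall i : 'I_m, nrm (y - root j s) <= nrm (y - root i s)) -> (size f <= D)%N ->
  \sum_(l < D) nrm (ev f^`N(l.+1) (s ^- N) (root j s)) * nrm (y - root j s) ^+ l <=
  3 ^+ m * nrm (ev (partial_y f) (s ^- N) y).
Proof.
move=> Hs near_j fD; set x := s ^- N; set r := root j s.
pose B l := ev (partial_y f)^`N(l) x r.
have E : \poly_(l < D) B l = u *: \prod_(i < m) ('X - (root i s - r)%:P).
  apply: poly_horner_inj => h; rewrite hornerZ horner_poly horner_prod.
  under [in RHS]eq_bigr do rewrite hornerXsubC opprB addrCA addrA.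
  by rewrite -Hs (ev_taylor x r h (leq_trans (size_partial_y f) fD)).
apply: (@le_trans _ _ (\sum_(l < D) nrm (B l) * nrm (y - r) ^+ l)).
  apply: ler_sum => l _; rewrite ler_wpM2r ?exprn_ge0 ?nrm_ge0//.
  rewrite /B nderivn_partial_y /ev !hornerMn -mulr_natr nrmM nrm_nat.
  by rewrite ler_peMr ?nrm_ge0// ler1n.
apply: (@le_trans _ _ (nrm u * \prod_(i < m) (nrm (y - r) + nrm (root i s - r)))).
  have := coef_prod_XsubC_bound m (fun i => root i s - r) D (nrm_ge0 (y - r)).
  move=> /(ler_wpM2l (nrm_ge0 u)); apply: le_trans; rewrite mulr_sumr.
  apply: ler_sum => l _; rewrite mulrA -nrmM -coefZ -E coef_poly ltn_ord//.
rewrite Hs nrmM mulrCA ler_wpM2l ?nrm_ge0// nrm_prod.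
have -> : 3 ^+ m = \prod_(i < m) 3 :> R by rewrite prodr_const card_ord.
rewrite -big_split /=; apply: ler_prod => i _.
rewrite addr_ge0 ?nrm_ge0//=.
have := nrmB (y - r) (y - root i s).
have -> : y - r - (y - root i s) = root i s - r by ring.
have := near_j i; rewrite -/r; lra.
Qed.

Lemma polar_estimate (C0 : R) (j : 'I_m) : exists2 C, 0 < C &
  \forall s \near punctured0, forall y, nrm y <= C0 * nrm (s ^- N) ->
    (forall i : 'I_m, nrm (y - root j s) <= nrm (y - root i s)) ->
    nrm (ev (partial_x f) (s ^- N) (root j s)) <=
    C * (nrm (ev (partial_x f) (s ^- N) y) + nrm (ev (partial_y f) (s ^- N) y)).
Proof.
have [root' Hroot] := mero_branch N (Hg j).
(* Euler derivatives of the Taylor coefficients of f at the root. *)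
pose d := size f.
pose b k s := ev f^`N(k) (s ^- N) (root j s).
pose b' k s := ev (partial_x f^`N(k)) (s ^- N) (root j s) * (- N%:R * s ^- N) +
               ev (partial_y f^`N(k)) (s ^- N) (root j s) * root' s.
have Hb k : mero (b k) (b' k) := mero_ev _ (mero_pole _ N) Hroot.
have /choice[K HK] : forall k, exists K, 0 < K /\
    \forall s \near punctured0, nrm (b' k s) <= K * nrm (b k s).
  by move=> k; have [K K0 HK] := mero_bound (Hb k); exists K.
have [C1 C10 HC1] := mero_bound Hroot.
have [A A0 HA] := analytic_bounded (Hg j).
pose K1 := \sum_(k < d) K k.+2.
have K10 : 0 <= K1 by apply: sumr_ge0 => k _; have [/ltW] := HK k.+2.
have Ab : 0 <= `|C0| + A by rewrite addr_ge0// ltW.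
(* The summand 1 accounts for f_x(x, y), [C1 * A] for the motion of the root, and the last one for
   the Taylor terms of order at least 2. *)
exists (1 + C1 * A + K1 * (`|C0| + A) * 3 ^+ m).
  have C1A : 0 <= C1 * A by rewrite mulr_ge0// ltW.
  have KA : 0 <= K1 * (`|C0| + A) * 3 ^+ m by rewrite !mulr_ge0// exprn_ge0.
  lra.
near=> s => y yX near_j.
have s0 : s != 0 by near: s; exact: punctured0_neq0.
have Hs : forall y, ev (partial_y f) (s ^- N) y = u * \prod_(i < m) (y - root i s) by near: s.
have gA : nrm (g j s) <= A by near: s.
have r'C : nrm (root' s) <= C1 * nrm (root j s) by near: s.
have b'1 : nrm (b' 1%N s) <= K 1%N * nrm (b 1%N s) by near: s; have [] := HK 1%N.
have b'k : forall k : 'I_d, nrm (b' k.+2 s) <= K k.+2 * nrm (b k.+2 s).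
  by near: s; apply: filter_forall => k; have [] := HK k.+2.
set x := s ^- N in yX *; set r := root j s in near_j *.
have x0 : 0 < nrm x by rewrite nrm_gt0 invr_eq0 expf_eq0 (negbTE s0) andbF.
have rA : nrm r <= A * nrm x.
  by rewrite nrmM mulrC ler_wpM2r ?nrm_ge0.
have r'A : nrm (root' s) <= C1 * A * nrm x.
  rewrite -mulrA (@le_trans _ _ (C1 * nrm r))//.
  by rewrite ler_wpM2l// ltW.
pose h := y - r.
have hX : nrm h <= (`|C0| + A) * nrm x.
  rewrite (le_trans (nrmB _ _))// mulrDl lerD//.
  by rewrite (le_trans yX)// ler_wpM2r ?nrm_ge0// ler_norm.
have yE : y = r + h by rewrite /h addrC subrK.
have fyr : ev (partial_y f) x r = 0.
  by rewrite Hs (bigD1 j)//= subrr mul0r mulr0.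
(* b_1 = f_y(x, r) is 0, and domination by b_1 forces its Euler derivative to vanish too. *)
have b1 : b' 1%N s = 0.
  apply/eqP; rewrite -nrm_eq0; apply/eqP/le_anti; rewrite nrm_ge0 andbT.
  by move: b'1; rewrite /b nderivn1 [ev _ _ _]fyr nrm0 mulr0.
have b0 : b' 0%N s = - (N%:R * x * ev (partial_x f) x r).
  by rewrite /b' nderivn0 -/x -/r fyr; ring.
(* Both sides are the Euler derivative of f(x, r + h) for fixed h, but the identity is checked term
   by term at the given s, so no curve through (x, y) is needed. *)
have taylor : ev (partial_x f) x y * (- N%:R * x) + ev (partial_y f) x y * root' s =
    \sum_(k < d.+2) b' k s * h ^+ k.
  have sx : (size (partial_x f) <= d.+2)%N.
    by rewrite (leq_trans (size_partial_x f))// -addn2 leq_addr.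
  have sy : (size (partial_y f) <= d.+2)%N.
    by rewrite (leq_trans (size_partial_y f))// -addn2 leq_addr.
  rewrite yE (ev_taylor _ _ _ sx) (ev_taylor _ _ _ sy) !mulr_suml -big_split /=.
  by apply: eq_bigr => k _; rewrite /b' partial_x_nderivn partial_y_nderivn -/x -/r; ring.
rewrite !big_ord_recl /= b0 b1 mul0r add0r expr0 mulr1 in taylor.
set S := \sum_(i < d) _ in taylor.
have SE : S = \sum_(k < d) b' k.+2 s * h ^+ k.+2 by [].
(* One factor |h| is kept apart: its bound by a multiple of |x| is what cancels the |x| on the left
   of [main]. *)
have SB : nrm S <= K1 * (nrm h * (3 ^+ m * nrm (ev (partial_y f) x y))).
  have TB := @taylor_bound s j y d.+1 Hs near_j (leqnSn d).
  rewrite -/x -/r -/h big_ord_recl in TB.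
  rewrite SE (le_trans (nrm_sum _ _ _))// mulr_suml.
  have T0 : 0 <= 3 ^+ m * nrm (ev (partial_y f) x y).
    by rewrite mulr_ge0 ?exprn_ge0 ?nrm_ge0.
  apply: ler_sum => k _; rewrite nrmM nrmX.
  apply: (@le_trans _ _ (K k.+2 * nrm (b k.+2 s) * nrm h ^+ k.+2)).
    by rewrite ler_wpM2r ?exprn_ge0 ?nrm_ge0.
  rewrite -mulrA ler_wpM2l//; first by have [/ltW] := HK k.+2.
  rewrite exprS mulrCA ler_wpM2l ?nrm_ge0// (le_trans _ TB)//.
  rewrite -[X in X <= _]add0r lerD ?mulr_ge0 ?exprn_ge0 ?nrm_ge0//.
  rewrite (bigD1 k)//= lerDl; apply: sumr_ge0 => i _.
  by rewrite mulr_ge0 ?exprn_ge0 ?nrm_ge0.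
have n1 : 1 <= N%:R :> R by rewrite ler1n.
have NX0 : 0 < N%:R * nrm x by rewrite mulr_gt0// ltr0n.
set P := nrm (ev (partial_x f) x r); set Q := nrm (ev (partial_x f) x y).
set T := nrm (ev (partial_y f) x y) in SB *.
have Q0 : 0 <= Q by apply: nrm_ge0.
have T0 : 0 <= T by apply: nrm_ge0.
have main : N%:R * nrm x * P <= N%:R * nrm x * Q + T * (C1 * A * nrm x) +
    K1 * (((`|C0| + A) * nrm x) * (3 ^+ m * T)).
  have -> : N%:R * nrm x * P = nrm (N%:R * x * ev (partial_x f) x r).
    by rewrite !nrmM nrm_nat.
  have -> : N%:R * x * ev (partial_x f) x r =
      N%:R * x * ev (partial_x f) x y - ev (partial_y f) x y * root' s + S.
    apply/eqP; rewrite -subr_eq0; apply/eqP; move: taylor => /eqP.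
    by rewrite -subr_eq0 => /eqP taylor; rewrite -{}taylor; ring.
  rewrite (le_trans (nrmD _ _))// lerD//.
    by rewrite (le_trans (nrmB _ _))// !nrmM nrm_nat lerD// ler_wpM2l.
  rewrite (le_trans SB)// ler_wpM2l// ler_wpM2r// mulr_ge0// exprn_ge0//.
rewrite -(ler_pM2l NX0) (le_trans main)//.
set c := C1 * A + K1 * (`|C0| + A) * 3 ^+ m.
have c0 : 0 <= c by rewrite addr_ge0 ?mulr_ge0 ?exprn_ge0// ltW.
have -> : N%:R * nrm x * Q + T * (C1 * A * nrm x) + K1 * ((`|C0| + A) * nrm x * (3 ^+ m * T)) =
  nrm x * (N%:R * Q + c * T) by rewrite /c; ring.
have -> : 1 + C1 * A + K1 * (`|C0| + A) * 3 ^+ m = 1 + c by rewrite /c; ring.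
rewrite -[N%:R * nrm x * ((1 + c) * _)]mulrA mulrCA ler_pM2l//.
have : c * T <= N%:R * (c * T) by rewrite ler_peMl// mulr_ge0.
have : 0 <= N%:R * (c * Q) by rewrite !mulr_ge0// ler0n.
have : 0 <= N%:R * T by rewrite !mulr_ge0// ler0n.
clear; lra.
Unshelve. all: by end_near. Qed.

End PolarEstimate.

(** * Laurent series and degrees at infinity *)

Section LaurentSeries.
Variable R : realType.
Implicit Types (phi psi : R[i] -> R[i]) (k : int).

Lemma cvg_nrmP (u : nat -> R[i]) (l : R[i]) :
  (u : nat -> R[i]^o) @ \oo --> (l : R[i]^o) <->
  forall e : R, 0 < e -> \forall n \near \oo, nrm (l - u n) < e.
Proof.
split=> [/cvgrPdist_lt H e e0|H]; last apply/cvgrPdist_lt => e.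
  have := H e%:C; rewrite ltcR => /(_ e0).
  by apply: filterS => n; rewrite nrmC ltcR.
rewrite ltcE => /andP[/eqP e2 e1] /=.
have := H (complex.Re e) e1; apply: filterS => n.
by rewrite nrmC; case: e e1 e2 => a b /= _ ->; rewrite ltcR.
Qed.

Lemma series_big (u : nat -> R[i]^o) n : series u n = \sum_(j < n) u j.
Proof. by rewrite seriesEord. Qed.

Lemma expansion_cvg c phi : expansion c phi -> \forall s \near punctured0,
  forall e : R, 0 < e -> \forall n \near \oo, nrm (phi s - \sum_(j < n) c j * s ^+ j) < e.
Proof.
move=> /(expansion_large 1 0) [A [M [A1 _ M0 H]]]; near=> s => e e0.
have s0 : s != 0 by near: s; exact: punctured0_neq0.
have sM : M * nrm s <= 2^-1.
  rewrite mulrC -ler_pdivlMr// ltW//; near: s; apply: punctured0_lt.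
  by rewrite divr_gt0 ?invr_gt0.
near=> n.
have A0 : 0 < A by lra.
have Ms0 : 0 <= M * nrm s by rewrite mulr_ge0 ?nrm_ge0 ?ltW.
have sM1 : M * nrm s <= 1 by lra.
apply: le_lt_trans (H s s0 sM1 n) _.
apply: (@le_lt_trans _ _ (A * 2^-1 ^+ n)).
  by rewrite ler_pM2l// lerXn2r ?nnegrE; lra.
rewrite exprVn ltr_pdivrMr ?exprn_gt0// mulrC -ltr_pdivrMr// upper_nthrootP//.
by near: n; exact: nbhs_infty_ge.
Unshelve. all: by end_near. Qed.

(** Convergence at a single point t0 bounds the terms there, so the coefficients grow at most
    geometrically and define a germ. It agrees with the given function because both are limits of
    the same partial sums. *)
Lemma laurent_expansion phi k c : laurent_at_infty phi k c ->
  expansion (fun j => c (k - j%:Z)) (fun s => phi s^-1 * s ^ k).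
Proof.
move=> [_ [r Hr]]; pose t0 : R[i] := (Num.max 1 (r + 1))%:C.
have nt0 : nrm t0 = Num.max 1 (r + 1).
  by rewrite nrm_real ger0_norm// le_max ler01.
have t0_gt0 : 0 < nrm t0 by rewrite nt0 lt_max ltr01.
have t00 : t0 != 0 by rewrite -nrm_gt0.
have rt0 : r < nrm t0 by rewrite nt0 lt_max; apply/orP; right; lra.
have H0 := Hr t0 rt0; rewrite cvg_nrmP in H0.
have [n0 _ Hn0] := H0 1 ltr01.
pose a j := c (k - j%:Z) * t0 ^ (k - j%:Z).
have aE j : nrm (c (k - j%:Z)) = nrm (a j) * nrm (t0 ^ k)^-1 * nrm t0 ^+ j.
  rewrite -nrmX -!nrmM /a; congr nrm; rewrite expfzDr// -exprnN.
  by field; rewrite expfz_neq0// expf_eq0 (negbTE t00) andbF.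
(* From [n0] on, consecutive partial sums are within 1 of the limit, so the terms are at most 2. *)
have [B B0 HB] : exists2 B, 0 <= B & forall j, nrm (a j) <= B.
  exists (2 + \sum_(j < n0) nrm (a j)) => [|j].
    by rewrite addr_ge0// sumr_ge0// => j _; apply: nrm_ge0.
  have S0 : 0 <= \sum_(j < n0) nrm (a j) by apply: sumr_ge0 => i _; apply: nrm_ge0.
  have [jn|nj] := ltnP j n0.
    rewrite (bigD1 (Ordinal jn))//= addrCA lerDl addr_ge0// sumr_ge0// => i _.
    exact: nrm_ge0.
  have := Hn0 j nj; have := Hn0 j.+1 (leqW nj); rewrite /= !series_big big_ord_recr /=.
  set S := \sum_(i < j) _; rewrite -/(a j) => h1 h2.
  have := nrmB (phi t0 - S) (phi t0 - (S + a j)).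
  by rewrite (_ : _ - S - _ = a j); [lra|ring].
have [|psi Hpsi] := @expansion_exists R (fun j => c (k - j%:Z)) (B * nrm (t0 ^ k)^-1) _ t0_gt0.
  move=> j; rewrite aE ler_wpM2r ?exprn_ge0 ?nrm_ge0//.
  by rewrite ler_wpM2r ?nrm_ge0.
apply: (expansion_eq _ Hpsi); near=> s.
have s0 : s != 0 by near: s; exact: punctured0_neq0.
have cpsi : forall e : R, 0 < e -> \forall n \near \oo,
    nrm (psi s - \sum_(j < n) c (k - j%:Z) * s ^+ j) < e.
  by near: s; exact: expansion_cvg Hpsi.
have rs : r < nrm s^-1.
  have s1 : nrm s < (nrm t0)^-1 by near: s; apply: punctured0_lt; rewrite invr_gt0.
  by rewrite (lt_le_trans rt0)// nrmV -[nrm t0]invrK lef_pV2 ?posrE ?invr_gt0 ?nrm_gt0// ltW.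
have := Hr _ rs; rewrite cvg_nrmP => cphi.
apply/eqP; rewrite -subr_eq0 -nrm_eq0; apply/eqP/le_anti; rewrite nrm_ge0 andbT.
apply/ler_addgt0Pl => e e0; rewrite addr0.
have sk0 : 0 < nrm (s ^ k) by rewrite nrm_gt0 expfz_neq0.
have e2 : 0 < e / 2 by rewrite divr_gt0.
have e3 : 0 < e / 2 / nrm (s ^ k) by rewrite divr_gt0.
near (\oo : set_system nat) => n.
have h1 : nrm (psi s - \sum_(j < n) c (k - j%:Z) * s ^+ j) < e / 2.
  by near: n; exact: cpsi.
have h2 : nrm (phi s^-1 - \sum_(j < n) c (k - j%:Z) * s^-1 ^ (k - j%:Z)) < e / 2 / nrm (s ^ k).
  by near: n; apply: filterS (cphi _ e3) => n; rewrite series_big.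
rewrite ltr_pdivlMr// -nrmM mulrBl mulr_suml in h2.
rewrite (eq_bigr (fun j : 'I_n => c (k - j%:Z) * s ^+ j)) in h2; last first.
  move=> j _; rewrite -mulrA; congr (_ * _).
  rewrite exprz_inv -expfzDr// (_ : - (k - j%:Z) + k = j%:Z)//; ring.
move: h1 h2; set S := \sum_(j < n) _ => h1 h2.
have := nrmB (psi s - S) (phi s^-1 * s ^ k - S).
by rewrite (_ : _ - S - _ = psi s - phi s^-1 * s ^ k); [lra|ring].
Unshelve. all: by end_near. Qed.

Lemma expansion_laurent c psi phi (k : nat) : expansion c psi ->
  (\forall s \near punctured0, phi s^-1 = psi s / s ^+ k) ->
  meromorphic_at_infty phi.
Proof.
move=> /expansion_cvg H1 H2; pose c' (m : int) := if m <= k%:Z then c `|k%:Z - m|%N else 0.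
exists k%:Z, c'; split; first by move=> m km; rewrite /c' leNgt km.
have [e e0 He] := filterI H1 H2.
exists e^-1 => t et; rewrite cvg_nrmP => d d0.
have t_gt0 : 0 < nrm t by rewrite (lt_trans _ et)// invr_gt0.
have t0 : t != 0 by rewrite -nrm_gt0.
have [|cvg1 E] := He t^-1.
  rewrite nrmV invr_gt0 t_gt0 /= -[e]invrK ltf_pV2 ?posrE ?invr_gt0//.
rewrite invrK in E.
have tk : 0 < nrm (t ^+ k) by rewrite nrm_gt0 expf_eq0 (negbTE t0) andbF.
have dt : 0 < d / nrm (t ^+ k) by rewrite divr_gt0.
apply: filterS (cvg1 _ dt) => n; rewrite series_big ltr_pdivlMr// -nrmM.
congr (nrm _ < d); rewrite E exprVn invrK mulrBl; congr (_ - _).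
rewrite mulr_suml; apply: eq_bigr => j _.
rewrite /c' gerBl lez_nat leq0n opprB addrC subrK absz_nat.
by rewrite expfzDr// exprVn -exprnN -exprnP; ring.
Qed.

End LaurentSeries.

Section Growth.
Variable R : realType.
Implicit Types (F G : R[i] -> R) (d e : \bar R) (phi : R[i] -> R[i]).

(* F s is comparable to |s|^-d, that is to |t|^d for t = 1/s at infinity. *)
Definition grows d F : Prop :=
  match d with
  | -oo%E => \forall s \near punctured0, F s = 0
  | EFin r => exists A B : R, [/\ 0 < A, 0 < B &
      \forall s \near punctured0, A * nrm s `^ (- r) <= F s <= B * nrm s `^ (- r)]
  | +oo%E => False
  end.

Lemma punctured0_powR_le (a b A B : R) : 0 < A ->
  (\forall s \near punctured0, A * nrm s `^ a <= B * nrm s `^ b) -> b <= a.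
Proof.
move=> A0 H; rewrite leNgt; apply/negP => ab.
pose B' := Num.max B 1; have B'0 : 0 < B' by rewrite lt_max ltr01 orbT.
have ba : 0 < b - a by rewrite subr_gt0.
have q0 : 0 < A / B' by rewrite divr_gt0.
near (@punctured0 R) => s.
have s_gt0 : 0 < nrm s by rewrite nrm_gt0; near: s; exact: punctured0_neq0.
have : A * nrm s `^ a <= B * nrm s `^ b by near: s.
apply/negP; rewrite -ltNge.
apply: (@le_lt_trans _ _ (B' * nrm s `^ b)).
  by rewrite ler_wpM2r ?powR_ge0// le_max lexx.
have -> : nrm s `^ b = nrm s `^ (b - a) * nrm s `^ a.
  by rewrite -powRD ?subrK// (gt_eqF s_gt0) implybT.
rewrite mulrA ltr_pM2r ?powR_gt0//.
rewrite mulrC -ltr_pdivlMr//.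
have -> : A / B' = ((A / B') `^ (b - a)^-1) `^ (b - a).
  by rewrite -powRrM mulVf ?gt_eqF// powRr1// ltW.
apply: gt0_ltr_powR; rewrite ?nnegrE ?powR_ge0 ?nrm_ge0//.
by near: s; apply: punctured0_lt; rewrite powR_gt0.
Unshelve. all: by end_near. Qed.

Lemma grows_eq d F G : (\forall s \near punctured0, F s = G s) -> grows d F -> grows d G.
Proof.
move=> E; case: d => [r|//|] /=; last by apply: filterS2 E => s ->.
move=> [A [B [A0 B0 H]]]; exists A, B; split=> //.
by apply: filterS2 E H => s ->.
Qed.

Lemma grows_le d e F G : grows d F -> grows e G ->
  (\forall s \near punctured0, F s <= G s) -> (d <= e)%E.
Proof.
case: d e => [r||] [q||] //=; rewrite ?leNye ?leey// => H1 H2 FG.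
  rewrite lee_fin -lerN2; move: H1 H2 => [A [A' [A0 _ HF]]] [B' [B [_ _ HG]]].
  apply: (@punctured0_powR_le _ _ A B A0).
  near=> s.
  have /andP[h1 _] : A * nrm s `^ (- r) <= F s <= A' * nrm s `^ (- r) by near: s.
  have /andP[_ h2] : B' * nrm s `^ (- q) <= G s <= B * nrm s `^ (- q) by near: s.
  by rewrite (le_trans h1)// (le_trans _ h2)//; near: s.
exfalso; have [A [A' [A0 _ HF]]] := H1.
near (@punctured0 R) => s.
have s_gt0 : 0 < nrm s by rewrite nrm_gt0; near: s; exact: punctured0_neq0.
have /andP[h1 _] : A * nrm s `^ (- r) <= F s <= A' * nrm s `^ (- r) by near: s.
have h2 : F s <= G s by near: s.
have h3 : G s = 0 by near: s.
have := mulr_gt0 A0 (powR_gt0 (- r) s_gt0); lra.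
Unshelve. all: by end_near. Qed.

Lemma grows_uniq d e F : grows d F -> grows e F -> d = e.
Proof.
have H : \forall s \near @punctured0 R, F s <= F s by apply: nearW.
by move=> H1 H2; apply/eqP; rewrite eq_le (grows_le H1 H2)// (grows_le H2 H1).
Qed.

Lemma powR_le_small (s : R[i]) (a b : R) : 0 < nrm s <= 1 -> a <= b ->
  nrm s `^ (- a) <= nrm s `^ (- b).
Proof.
move=> /andP[s0 s1] ab; rewrite !powRN lef_pV2 ?posrE ?powR_gt0//.
by apply: ger_powR => //; rewrite s0.
Qed.

Lemma grows_max d e F G : (forall s, 0 <= F s) -> (forall s, 0 <= G s) ->
  grows d F -> grows e G -> grows (maxe d e) (fun s => Num.max (F s) (G s)).
Proof.
move=> F0 G0.
case: d e => [r||] [q||] //=; rewrite ?maxNye ?maxeNy -?EFin_max//=.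
- move=> [A [B [A0 B0 HF]]] [A' [B' [A'0 B'0 HG]]].
  exists (Num.min A A'), (Num.max B B').
  split; rewrite ?lt_min ?lt_max ?A0 ?A'0 ?B0//; near=> s.
  have s_gt0 : 0 < nrm s by rewrite nrm_gt0; near: s; exact: punctured0_neq0.
  have s1 : nrm s <= 1 by apply/ltW; near: s; exact: punctured0_lt.
  have /andP[f1 f2] : A * nrm s `^ (- r) <= F s <= B * nrm s `^ (- r) by near: s.
  have /andP[g1 g2] : A' * nrm s `^ (- q) <= G s <= B' * nrm s `^ (- q) by near: s.
  have s01 : 0 < nrm s <= 1 by rewrite s_gt0.
  have m1 : Num.min A A' <= A by rewrite ge_min lexx.
  have m2 : Num.min A A' <= A' by rewrite ge_min lexx orbT.
  have m3 : B <= Num.max B B' by rewrite le_max lexx.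
  have m4 : B' <= Num.max B B' by rewrite le_max lexx orbT.
  have B''0 : 0 <= Num.max B B' by rewrite le_max (ltW B0).
  apply/andP; split.
    rewrite le_max; case: (leP r q) => rq; apply/orP; [right|left].
      by rewrite (le_trans _ g1)// ler_wpM2r ?powR_ge0.
    by rewrite (le_trans _ f1)// ler_wpM2r ?powR_ge0.
  rewrite ge_max; apply/andP; split.
    apply: (le_trans f2); apply: ler_pM => //; [exact: ltW|exact: powR_ge0|].
    by apply: powR_le_small => //; rewrite le_max lexx.
  apply: (le_trans g2); apply: ler_pM => //; [exact: ltW|exact: powR_ge0|].
  by apply: powR_le_small => //; rewrite le_max lexx orbT.
- move=> [A [B [A0 B0 HF]]] HG; exists A, B; split=> //; near=> s.
  have -> : G s = 0 by near: s.
  by rewrite (max_idPl (F0 s)); near: s.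
- move=> HF [A [B [A0 B0 HG]]]; exists A, B; split=> //; near=> s.
  have -> : F s = 0 by near: s.
  by rewrite (max_idPr (G0 s)); near: s.
- by move=> HF HG; apply: filterS2 HF HG => s -> ->; rewrite maxxx.
Unshelve. all: by end_near. Qed.

Lemma mero_grows phi phi' : mero phi phi' -> exists d, grows d (fun s => nrm (phi s)).
Proof.
move=> /mero_order[H|[k [A [B [A0 B0 H]]]]].
  by exists -oo%E; apply: filterS H => s ->; exact: nrm0.
exists (- k%:~R)%:E, A, B; split=> //.
by apply: filterS H => s; rewrite opprK powR_intmul// nrm_ge0.
Qed.

Lemma laurent_growth phi k c : laurent_at_infty phi k c ->
  ((forall m, c m = 0) /\ \forall s \near punctured0, phi s^-1 = 0) \/
  exists d : int, [/\ c d != 0, forall m, d < m -> c m = 0 &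
    grows (d%:~R)%:E (fun s => nrm (phi s^-1))].
Proof.
move=> Hphi; have [c_gt _] := Hphi.
have c_le m : m <= k -> c m = c (k - `|k - m|%N%:Z).
  by move=> mk; congr c; rewrite gez0_abs ?subr_ge0//; ring.
have He := laurent_expansion Hphi.
have [c0|[j [chi [cj cz Hchi E]]]] := expansion_lead He.
  left; split=> [m|]; first by have [/c_gt//|/c_le ->] := ltP k m.
  near=> s; have s0 : s != 0 by near: s; exact: punctured0_neq0.
  have : phi s^-1 * s ^ k = 0 by near: s; exact: expansion0 He c0.
  by move=> /eqP; rewrite mulf_eq0 (negbTE (expfz_neq0 _ s0)) orbF => /eqP.
right; exists (k - j%:Z); split=> //.
  move=> m jm; have [/c_gt//|mk] := ltP k m.
  by rewrite c_le// cz// -ltz_nat gez0_abs ?subr_ge0// ltrBlDr addrC -ltrBlDr.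
have cj0 : 0 < nrm (c (k - j%:Z)) by rewrite nrm_gt0.
have := expansion_unit Hchi; rewrite addn0 => /(_ cj) Hu.
exists (nrm (c (k - j%:Z)) / 2), (2 * nrm (c (k - j%:Z))).
split; [by rewrite divr_gt0|by rewrite mulr_gt0|near=> s].
have s0 : s != 0 by near: s; exact: punctured0_neq0.
have s_gt0 : 0 < nrm s by rewrite nrm_gt0.
have -> : phi s^-1 = chi s * s ^ (j%:Z - k).
  apply: (mulIf (expfz_neq0 k s0)); rewrite E// -mulrA -expfzDr// subrK.
  by rewrite -exprnP mulrC.
have nz m : nrm (s ^ m) = nrm s ^ m.
  by case: m => m; rewrite ?NegzE -?exprnN ?nrmV -?exprnP nrmX.
rewrite nrmM nz -mulrNz opprB powR_intmul ?nrm_ge0//.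
by rewrite !ler_pM2r ?exprz_gt0//; near: s.
Unshelve. all: by end_near. Qed.

(** The degree is a supremum over all Laurent representations; growth rates being unique, every one
    of them has the same top index. *)
Lemma degree_grows phi : meromorphic_at_infty phi ->
  grows (degree_at_infty phi) (fun s => nrm (phi s^-1)).
Proof.
move=> [k [c Hphi]].
have [[c0 phi0]|[d [cd c_gt Hd]]] := laurent_growth Hphi.
  have gN : grows -oo%E (fun s => nrm (phi s^-1)).
    by apply: filterS phi0 => s ->; exact: nrm0.
  suff -> : degree_at_infty phi = -oo%E by [].
  rewrite /degree_at_infty (_ : [set _ | m in _] = set0) ?ereal_sup0//.
  rewrite -subset0 => _ [m [k' [c' [Hphi' c'm]]] _] /=.
  have [[c'0 _]|[d [_ _ Hd]]] := laurent_growth Hphi'; first by move: c'm; rewrite c'0 eqxx.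
  by have := grows_uniq gN Hd.
suff -> : degree_at_infty phi = (d%:~R)%:E by [].
apply/eqP; rewrite eq_le; apply/andP; split; last first.
  by apply: ereal_sup_ubound; exists d => //; exists k, c.
apply: ge_ereal_sup => _ [m [k' [c' [Hphi' c'm]]] <-] /=.
have [[c'0 _]|[d' [_ c'_gt Hd']]] := laurent_growth Hphi'; first by move: c'm; rewrite c'0 eqxx.
have [/intr_inj dd'] := grows_uniq Hd Hd'.
rewrite lee_fin ler_int leNgt; apply/negP; rewrite dd' => /c'_gt c'0.
by move: c'm; rewrite c'0 eqxx.
Qed.

Lemma maxnorm2 (z : 'rV[R[i]]_2) :
  maxnorm z = Num.max (nrm (z 0 0)) (nrm (z 0 1)).
Proof.
rewrite /maxnorm !big_ord_recl big_ord0 (_ : lift ord0 ord0 = 1); last exact: val_inj.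
by congr Num.max; apply/max_idPl; exact: nrm_ge0.
Qed.

Lemma bigmaxe2 (D : 'I_2 -> \bar R) : \big[maxe/-oo%E]_(i < 2) D i = maxe (D 0) (D 1).
Proof.
rewrite !big_ord_recl big_ord0 maxeNy; congr (maxe _ (D _)).
exact: val_inj.
Qed.

Lemma degree_tuple2 (Phi : R[i] -> 'rV[R[i]]_2) : degree_tuple Phi =
  maxe (degree_at_infty (fun t => Phi t 0 0)) (degree_at_infty (fun t => Phi t 0 1)).
Proof. exact: (bigmaxe2 (fun i => degree_at_infty (fun t => Phi t 0 i))). Qed.

Lemma degree_tuple_grows (Phi : R[i] -> 'rV[R[i]]_2) :
  (forall i, meromorphic_at_infty (fun t => Phi t 0 i)) ->
  grows (degree_tuple Phi) (fun s => maxnorm (Phi s^-1)).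
Proof.
move=> H; rewrite degree_tuple2.
apply: (@grows_eq _ (fun s => Num.max (nrm (Phi s^-1 0 0)) (nrm (Phi s^-1 0 1)))).
  by apply: nearW => s; rewrite maxnorm2.
by apply: grows_max => [s|s||]; rewrite ?nrm_ge0//; apply: degree_grows.
Qed.

Lemma mero_of_meromorphic phi : meromorphic_at_infty phi ->
  exists phi', mero (fun s => phi s^-1) phi'.
Proof.
move=> [k [c /laurent_expansion H]].
have [psi Hpsi] : exists psi, euler (fun s => phi s^-1 * s ^ k) psi.
  by apply: euler_exists; eexists; apply: H.
case: k {H} Hpsi => n Hpsi.
  exists (fun s => (psi s - n%:R * (phi s^-1 * s ^+ n)) / s ^+ n), n.
  exists (fun s => phi s^-1 * s ^+ n), psi; split=> //; last exact: nearW.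
  apply: filterS (@punctured0_neq0 R) => s s0.
  by rewrite mulfK// expf_eq0 (negbTE s0) andbF.
eexists; apply: mero_eq (meroM (mero_euler Hpsi) (mero_euler (euler_exp R n.+1))).
  apply: filterS (@punctured0_neq0 R) => s s0.
  by rewrite NegzE -exprnN divfK// expf_eq0 (negbTE s0) andbF.
exact: nearW.
Qed.

Lemma meromorphic_of_mero phi phi' : mero (fun s => phi s^-1) phi' ->
  meromorphic_at_infty phi.
Proof. by move=> [k [psi [_ [[c [Hc _]] E _]]]]; apply: expansion_laurent Hc E. Qed.

End Growth.

(** * Exponents at infinity *)

Section AtInfinity.
Variable R : realType.

Lemma horner_growth (q : {poly R[i]}) d : (size q <= d.+1)%N ->
  exists2 B : R, 0 <= B & forall x, nrm q.[x] <= B * Num.max 1 (nrm x) ^+ d.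
Proof.
move=> qd; exists (\sum_(l < d.+1) nrm q`_l).
  by apply: sumr_ge0 => l _; apply: nrm_ge0.
move=> x; set M := Num.max 1 (nrm x).
have M1 : 1 <= M by rewrite le_max lexx.
rewrite (horner_coef_wide _ qd) (le_trans (nrm_sum _ _ _))// mulr_suml.
apply: ler_sum => l _; rewrite nrmM nrmX ler_wpM2l ?nrm_ge0//.
apply: (@le_trans _ _ (M ^+ l)).
  by apply: lerXn2r; rewrite ?nnegrE ?nrm_ge0 ?le_max ?ler01 ?lexx ?orbT.
by rewrite ler_weXn2l// -ltnS.
Qed.

Variables (F : {poly {poly R[i]}}) (m : nat) (u : R[i]).
Hypothesis u0 : u != 0.
Hypothesis sF : (size F <= m.+1)%N.
Hypothesis Fm : F`_m = u%:P.
Hypothesis Fj : forall j, (j < m)%N -> (size (F`_j)%R <= (m - j).+1)%N.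

Lemma ev_coef x y : ev F x y = \sum_(j < m) (F`_j).[x] * y ^+ j + u * y ^+ m.
Proof.
rewrite /ev (horner_coef_wide _ sF) horner_sum big_ord_recr /= Fm.
rewrite -polyC_exp hornerM !hornerC; congr (_ + _); apply: eq_bigr => j _.
by rewrite -polyC_exp hornerM hornerC.
Qed.

(** The terms of lower degree in y total at most |y|^m once |y| >= (1 + S) max(1, |x|), and |u| >= 2
    leaves a further |y|^m. For f_y one has u = n, which is why n > 1 suffices. *)
Lemma far_bound : 2 <= nrm u -> exists2 C0 : R, 1 <= C0 & forall x y,
  C0 * Num.max 1 (nrm x) <= nrm y -> nrm y ^+ m <= nrm (ev F x y).
Proof.
move=> u2.
have /choice[B HB] : forall j, exists B : R, 0 <= B /\ ((j < m)%N ->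
    forall x, nrm (F`_j).[x] <= B * Num.max 1 (nrm x) ^+ (m - j)).
  move=> j; have [jm|mj] := ltnP j m; last by exists 0.
  by have [B B0 HB] := horner_growth (Fj jm); exists B.
pose S := \sum_(j < m) B j.
have S0 : 0 <= S by apply: sumr_ge0 => j _; have [] := HB j.
exists (1 + S); first by rewrite lerDl.
move=> x y; set M := Num.max 1 (nrm x) => My.
have M1 : 1 <= M by rewrite le_max lexx.
have C0 : 0 < 1 + S by lra.
have low : nrm (\sum_(j < m) (F`_j).[x] * y ^+ j) <= nrm y ^+ m.
  apply: (@le_trans _ _ (\sum_(j < m) B j * (nrm y ^+ m / (1 + S)))); last first.
    rewrite -mulr_suml -/S mulrCA ler_piMr ?exprn_ge0 ?nrm_ge0//.
    by rewrite ler_pdivrMr// mul1r lerDr.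
  rewrite (le_trans (nrm_sum _ _ _))//; apply: ler_sum => j _.
  have [Bj /(_ (ltn_ord j) x) HBj] := HB j.
  rewrite nrmM nrmX (le_trans (ler_wpM2r _ HBj)) ?exprn_ge0 ?nrm_ge0//.
  rewrite -mulrA ler_wpM2l// -/M ler_pdivlMr//.
  rewrite -[in leRHS](subnK (ltnW (ltn_ord j))) exprD mulrAC ler_wpM2r ?exprn_ge0 ?nrm_ge0//.
  have : (0 < m - j)%N by rewrite subn_gt0.
  case: (m - j)%N => // k _; rewrite !exprS mulrAC ler_pM ?mulr_ge0 ?exprn_ge0//; try lra.
  apply: lerXn2r; rewrite ?nnegrE ?nrm_ge0//; try lra.
  by rewrite (le_trans _ My)// ler_peMl//; lra.
have := nrm_subr_ge (u * y ^+ m) (- \sum_(j < m) (F`_j).[x] * y ^+ j).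
rewrite opprK nrmN ev_coef [u * _ + _]addrC nrmM nrmX.
have : 2 * nrm y ^+ m <= nrm u * nrm y ^+ m by rewrite ler_wpM2r// exprn_ge0 ?nrm_ge0.
lra.
Qed.

(** The substitution x = 1/s, y = w/s brings infinity to s = 0: by the degree conditions s^m F(1/s,
    w/s) / u is monic in w with coefficients polynomial in s. *)
Lemma puiseux_infty : exists (N : nat) (g : nat -> R[i] -> R[i]),
  [/\ (0 < N)%N, forall i, analytic (g i) &
    \forall s \near punctured0, forall y,
      ev F (s ^- N) y = u * \prod_(i < m) (y - s ^- N * g i s)].
Proof.
pose b j s := u^-1 * \sum_(l < (m - j).+1) (F`_j)`_l * s ^+ (m - j - l).
pose p s := 'X^m + \poly_(j < m) b j s.
have Hb j : analytic (b j).
  apply: analyticM; first exact: analytic_cst.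
  apply: (@analytic_sum _ _ (fun l s => (F`_j)`_l * s ^+ (m - j - l))) => l.
  by apply: analyticM; [exact: analytic_cst|exact/analyticX/analytic_var].
have Hp : analytic_family p.
  move=> j; rewrite /p; under eq_fun do rewrite coefD coefXn coef_poly.
  apply: analyticD; first exact: analytic_cst.
  by case: ltnP => _; [exact: Hb|exact: analytic_cst].
have mp s : p s \is monic /\ size (p s) = m.+1.
  by rewrite /p monic_monic_poly size_monic_poly.
have [N [g [N0 Hg E]]] := puiseux Hp mp.
exists N, g; split=> //; near=> s => y.
have s0 : s != 0 by near: s; exact: punctured0_neq0.
have Es : forall w, (p (s ^+ N)).[w] = \prod_(i < m) (w - g i s) by near: s.
set x := s ^+ N in Es *; have x0 : x != 0 by rewrite expf_eq0 (negbTE s0) andbF.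
have -> : \prod_(i < m) (y - x^-1 * g i s) = x ^- m * (p x).[x * y].
  rewrite Es -exprVn -[X in _ ^+ X](card_ord m) -prodr_const -big_split /=.
  by apply: eq_bigr => i _; field.
rewrite ev_coef /p hornerD hornerXn horner_poly !mulrDr addrC; congr (_ + _).
  by rewrite exprMn mulKf// expf_eq0 (negbTE x0) andbF.
rewrite !mulr_sumr; apply: eq_bigr => j _; rewrite /b.
rewrite (horner_coef_wide _ (Fj (ltn_ord j))) exprMn.
have -> : u * (x ^- m * (u^-1 * (\sum_(l < (m - j).+1) (F`_j)`_l * x ^+ (m - j - l)) *
    (x ^+ j * y ^+ j))) =
  (\sum_(l < (m - j).+1) (F`_j)`_l * x ^+ (m - j - l)) * (x ^- m * x ^+ j) * y ^+ j.
  by field; rewrite expf_eq0 (negbTE x0) andbF.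
congr (_ * _); rewrite mulr_suml; apply: eq_bigr => l _; rewrite -mulrA; congr (_ * _).
have -> : x ^+ m = x ^+ (m - j - l) * x ^+ l * x ^+ j.
  by rewrite -!exprD; congr (_ ^+ _); have := ltn_ord l; have := ltn_ord j; lia.
by rewrite exprVn; field; rewrite !expf_neq0.
Unshelve. all: by end_near. Qed.

End AtInfinity.

Section Exponents.
Variable R : realType.
Implicit Types (f : {poly {poly R[i]}}) (z : 'rV[R[i]]_2).

Lemma maxnorm_gradient f z : maxnorm (gradient f z) =
  Num.max (nrm (ev (partial_x f) (z 0 0) (z 0 1))) (nrm (ev (partial_y f) (z 0 0) (z 0 1))).
Proof. by rewrite maxnorm2 !mxE. Qed.

(** The sign of [nu] decides which end of the interval is the worse one, hence the minimum in the
    constant. *)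
Lemma powR_comparable (a b nu : R) : 0 < a -> 0 < b -> exists2 c : R, 0 < c &
  forall q x : R, 0 < q -> a * q <= x <= b * q -> c * q `^ nu <= x `^ nu.
Proof.
move=> a0 b0; exists (Num.min (a `^ nu) (b `^ nu)); first by rewrite lt_min !powR_gt0.
move=> q x q0 /andP[ax xb].
have x0 : 0 < x by rewrite (lt_le_trans _ ax)// mulr_gt0.
have [nu0|nu0] := leP 0 nu.
  apply: (@le_trans _ _ ((a * q) `^ nu)).
    by rewrite powRM ?(ltW a0) ?(ltW q0)// ler_wpM2r ?powR_ge0// ge_min lexx.
  by apply: ge0_ler_powR; rewrite ?nnegrE ?mulr_ge0// ltW.
apply: (@le_trans _ _ ((b * q) `^ nu)).
  by rewrite powRM ?(ltW b0) ?(ltW q0)// ler_wpM2r ?powR_ge0// ge_min lexx orbT.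
rewrite -[nu]opprK !(powRN _ (- nu)) lef_pV2 ?posrE ?powR_gt0 ?mulr_gt0//.
by apply: ge0_ler_powR; rewrite ?nnegrE ?mulr_ge0// ?oppr_ge0 ltW.
Qed.

Lemma exponents_down f S (nu nu' : R) : nu' <= nu ->
  exponents (gradient f) S nu -> exponents (gradient f) S nu'.
Proof.
move=> nn [A [B [A0 B0 H]]]; exists A, (Num.max B 1); split=> //.
  by rewrite lt_max B0.
move=> z Sz; rewrite gt_max => /andP[Bz z1]; rewrite (le_trans _ (H z Sz Bz))//.
by rewrite ler_wpM2l ?(ltW A0)// ler_powR// ltW.
Qed.

Lemma grows_infty (r : R) (F : R[i] -> R) (B : R) : 0 < r -> grows r%:E F ->
  \forall s \near punctured0, B < F s.
Proof.
move=> r0 [A [A' [A0 _ H]]].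
pose B' := Num.max (B / A) 1; have B'0 : 0 < B' by rewrite lt_max ltr01 orbT.
near=> s.
have s_gt0 : 0 < nrm s by rewrite nrm_gt0; near: s; exact: punctured0_neq0.
have /andP[h _] : A * nrm s `^ (- r) <= F s <= A' * nrm s `^ (- r) by near: s.
apply: lt_le_trans h; rewrite mulrC -ltr_pdivrMr//.
apply: (@le_lt_trans _ _ B'); first by rewrite le_max lexx.
rewrite powRN -[B']invrK ltf_pV2 ?posrE ?invr_gt0 ?powR_gt0//.
have -> : B'^-1 = (B'^-1 `^ r^-1) `^ r.
  by rewrite -powRrM mulVf ?gt_eqF// powRr1// invr_ge0 ltW.
apply: gt0_ltr_powR; rewrite ?nnegrE ?powR_ge0 ?nrm_ge0//.
by near: s; apply: punctured0_lt; rewrite powR_gt0 ?invr_gt0.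
Unshelve. all: by end_near. Qed.

Lemma gradient_meromorphic f (Phi : R[i] -> 'rV[R[i]]_2) :
  (forall i, meromorphic_at_infty (fun t => Phi t 0 i)) ->
  forall i, meromorphic_at_infty (fun t => gradient f (Phi t) 0 i).
Proof.
move=> H i.
have [X' HX] := mero_of_meromorphic (H 0); have [Y' HY] := mero_of_meromorphic (H 1).
pose g := if i == 0 then partial_x f else partial_y f.
apply: meromorphic_of_mero.
rewrite (_ : (fun s => _) = fun s => ev g (Phi s^-1 0 0) (Phi s^-1 0 1)).
  exact: mero_ev HX HY.
by apply/funext => s; rewrite mxE /g; case: ifP.
Qed.

(** The inequality becomes one between |s|^(-d nu) and |s|^(-e), and the exponents compare as s
    tends to 0. *)
Lemma grows_exponent (d e : \bar R) (F G : R[i] -> R) (nu A B : R) : (0 < d)%E ->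
    grows d F -> grows e G -> 0 < A ->
    (\forall s \near punctured0, B < F s -> A * F s `^ nu <= G s) ->
  (nu%:E <= e / d)%E.
Proof.
case: d => [r||]//; rewrite lte_fin => r0 HF HG A0 H.
have FB := grows_infty (Num.max B 0) r0 HF; have [a [b [a0 b0 HF']]] := HF.
have [c c0 Hc] := powR_comparable nu a0 b0.
have low : \forall s \near punctured0, A * c * nrm s `^ (- (r * nu)) <= G s.
  near=> s.
  have s_gt0 : 0 < nrm s by rewrite nrm_gt0; near: s; exact: punctured0_neq0.
  have BF : Num.max B 0 < F s by near: s.
  move: BF; rewrite gt_max => /andP[BF F0].
  have ab : a * nrm s `^ (- r) <= F s <= b * nrm s `^ (- r) by near: s.
  have HG' : A * F s `^ nu <= G s by move: BF; near: s.
  rewrite (le_trans _ HG')// -mulrA ler_wpM2l ?(ltW A0)//.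
  by rewrite (le_trans _ (Hc _ _ _ ab)) ?powR_gt0// -powRrM mulNr.
have Ac : 0 < A * c by rewrite mulr_gt0.
case: e HG => [q||]//=.
  move=> [a' [b' [_ _ HG']]].
  rewrite inver gt_eqF// -EFinM lee_fin ler_pdivlMr// mulrC -lerN2.
  apply: (@punctured0_powR_le _ _ _ (A * c) b') => //; near=> s.
  have /andP[_ h] : a' * nrm s `^ (- q) <= G s <= b' * nrm s `^ (- q) by near: s.
  by rewrite (le_trans _ h)//; near: s.
move=> G0; exfalso; near (@punctured0 R) => s.
have s_gt0 : 0 < nrm s by rewrite nrm_gt0; near: s; exact: punctured0_neq0.
have h : A * c * nrm s `^ (- (r * nu)) <= G s by near: s.
have h0 : G s = 0 by near: s.
by have := mulr_gt0 Ac (powR_gt0 (- (r * nu)) s_gt0); lra.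
Unshelve. all: by end_near. Qed.

Lemma lojasiewicz_le_at f lambda :
  (lojasiewicz (gradient f) setT <= lojasiewicz_at f lambda)%E.
Proof.
apply: ge_ereal_sup => _ [nu [A [B [A0 B0 H]]] <-].
apply: le_ereal_inf_tmp => _ [Phi [HPhi deg_gt0 _] <-].
have HG i : meromorphic_at_infty (fun t => (gradient f \o Phi) t 0 i).
  exact: gradient_meromorphic.
have H' : \forall s \near punctured0, B < maxnorm (Phi s^-1) ->
    A * maxnorm (Phi s^-1) `^ nu <= maxnorm ((gradient f \o Phi) s^-1).
  by apply: nearW => s BPhi; apply: H.
exact: grows_exponent deg_gt0 (degree_tuple_grows HPhi) (degree_tuple_grows HG) A0 H'.
Qed.

End Exponents.

(** * Polar branches near infinity and the transfer of exponents *)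

Lemma ramified_root (R : realType) (N : nat) (x : R[i]) : (0 < N)%N -> x != 0 ->
  exists2 s, s != 0 & s ^- N = x.
Proof.
move=> N0 x0.
have /closed_rootP[s] : size ('X^N - (x^-1)%:P) != 1%N.
  by rewrite size_XnsubC// eqSS -lt0n.
rewrite rootE !hornerE subr_eq0 => /eqP sN; exists s.
  by apply: contraNneq x0 => s0; rewrite -invr_eq0 -sN s0 expr0n eqn0Ngt N0.
by rewrite sN invrK.
Qed.

(** Statements on germs in s become statements on all large x, since every such x has the form
    s^-N. *)
Lemma near_infinity (R : realType) (N : nat) (P : R[i] -> Prop) : (0 < N)%N ->
  (\forall s \near punctured0, P s) ->
  exists2 B : R, 0 < B & forall x, B < nrm x ->
    exists s, [/\ s != 0, nrm s <= 1, s ^- N = x & P s].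
Proof.
move=> N0 [e e0 He]; pose d := Num.min 1 e; have d0 : 0 < d by rewrite lt_min ltr01.
exists (d ^- N) => [|x Bx]; first by rewrite invr_gt0 exprn_gt0.
have x0 : x != 0 by rewrite -nrm_gt0 (lt_trans _ Bx)// invr_gt0 exprn_gt0.
have [s s0 sx] := ramified_root N0 x0.
have s_gt0 : 0 < nrm s by rewrite nrm_gt0.
have sd : nrm s < d.
  move: Bx; rewrite -sx nrmV nrmX ltf_pV2 ?posrE ?exprn_gt0//.
  by rewrite ltr_pXn2r// nnegrE ltW.
move: sd; rewrite lt_min => /andP[s1 se].
by exists s; split=> //; [exact: ltW|apply: He; rewrite s_gt0].
Qed.

Section Polar.
Variable R : realType.
Variables (f : {poly {poly R[i]}}) (N m : nat) (u : R[i]) (g : nat -> R[i] -> R[i]) (C0 : R).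
Hypothesis N0 : (0 < N)%N.
Hypothesis m0 : (0 < m)%N.
Hypothesis u0 : u != 0.
Hypothesis Hg : forall i, analytic (g i).
Hypothesis splitH : \forall s \near punctured0, forall y,
  ev (partial_y f) (s ^- N) y = u * \prod_(i < m) (y - s ^- N * g i s).
Hypothesis C01 : 1 <= C0.
Hypothesis far : forall x y, C0 * Num.max 1 (nrm x) <= nrm y ->
  nrm y ^+ m <= nrm (ev (partial_y f) x y).

Local Notation root j s := (s ^- N * g j s).

Lemma far_or_near (x y : R[i]) : C0 < Num.max (nrm x) (nrm y) ->
  [/\ C0 * Num.max 1 (nrm x) <= nrm y, 1 <= nrm y & Num.max (nrm x) (nrm y) = nrm y] \/
  [/\ nrm y <= C0 * nrm x & Num.max (nrm x) (nrm y) <= C0 * nrm x].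
Proof.
have nx := nrm_ge0 x; have ny := nrm_ge0 y.
have xC : nrm x <= C0 * nrm x by rewrite ler_peMl.
move=> Cz; have [h|h] := leP (C0 * Num.max 1 (nrm x)) (nrm y).
  left; have M1 : 1 <= Num.max 1 (nrm x) by rewrite le_max lexx.
  have Mx : nrm x <= Num.max 1 (nrm x) by rewrite le_max lexx orbT.
  have MC : Num.max 1 (nrm x) <= C0 * Num.max 1 (nrm x) by rewrite ler_peMl//; lra.
  by split; [by []|lra|apply/max_idPr; lra].
right; have [x1|x1] := leP 1 (nrm x).
  by move: h; rewrite (max_idPr x1) => /ltW h; rewrite ge_max xC h.
exfalso; move: h Cz; rewrite (max_idPl (ltW x1)) mulr1 lt_max => h /orP[h2|h2].
  by have := lt_le_trans (lt_trans h2 x1) C01; rewrite ltxx.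
by have := lt_trans h h2; rewrite ltxx.
Qed.

Lemma root_bound : exists2 A : R, 1 <= A &
  \forall s \near punctured0, forall j : 'I_m, nrm (root j s) <= A * nrm (s ^- N).
Proof.
have /choice[A HA] : forall j, exists A : R,
    0 < A /\ \forall s \near punctured0, nrm (g j s) <= A.
  by move=> j; have [A A0 HA] := analytic_bounded (Hg j); exists A.
have A_ge0 j : 0 <= A j by have [/ltW] := HA j.
exists (1 + \sum_(j < m) A j); first by rewrite lerDl sumr_ge0.
have H : \forall s \near punctured0, forall j : 'I_m, nrm (g j s) <= A j.
  by apply: filter_forall => j; have [] := HA j.
apply: filterS H => s Hs j; rewrite nrmM mulrC ler_wpM2r ?nrm_ge0//.
by rewrite (le_trans (Hs j))// (bigD1 j)//= addrCA lerDl addr_ge0// sumr_ge0.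
Qed.

Lemma nearest_root s y : exists j : 'I_m, forall i : 'I_m,
  nrm (y - root j s) <= nrm (y - root i s).
Proof.
pose F (i : 'I_m) := nrm (y - root i s).
case: (@Order.TotalTheory.arg_minP _ _ _ (Ordinal m0) xpredT F isT) => j _ H.
by exists j => i; apply: H.
Qed.

(** In the far region |f_y| >= |y|^m, which suffices as long as nu <= m. Elsewhere the point is
    moved along its vertical line to the nearest root of f_y: the new point lies on the polar curve
    and has comparable norm, and [polar_estimate] compares the gradients. *)
Lemma exponents_polar nu : nu <= m%:R ->
  exponents (gradient f) (polar_curve_y f) nu -> exponents (gradient f) setT nu.
Proof.
move=> num [A [B [A0 B0 H]]].
have [A1 A11 HA1] := root_bound.
have /choice[K HK] : forall j : 'I_m, exists K : R, 0 < K /\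
    \forall s \near punctured0, forall y, nrm y <= C0 * nrm (s ^- N) ->
    (forall i : 'I_m, nrm (y - root j s) <= nrm (y - root i s)) ->
    nrm (ev (partial_x f) (s ^- N) (root j s)) <=
    K * (nrm (ev (partial_x f) (s ^- N) y) + nrm (ev (partial_y f) (s ^- N) y)).
  by move=> j; have [K K0 HK] := polar_estimate N0 Hg splitH C0 j; exists K.
pose K1 := 1 + \sum_(j < m) K j.
have K_ge0 j : 0 <= K j by have [/ltW] := HK j.
have K10 : 0 < K1 by rewrite ltr_pwDl// sumr_ge0.
have KK j : K j <= K1.
  by rewrite /K1 (bigD1 j)//= addrCA lerDl addr_ge0// sumr_ge0.
have nearP : \forall s \near punctured0,
   [/\ forall y, ev (partial_y f) (s ^- N) y = u * \prod_(i < m) (y - root i s),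
       forall j : 'I_m, nrm (root j s) <= A1 * nrm (s ^- N) &
       forall j : 'I_m, forall y, nrm y <= C0 * nrm (s ^- N) ->
    (forall i : 'I_m, nrm (y - root j s) <= nrm (y - root i s)) ->
    nrm (ev (partial_x f) (s ^- N) (root j s)) <=
    K j * (nrm (ev (partial_x f) (s ^- N) y) + nrm (ev (partial_y f) (s ^- N) y))].
  near=> s; split; near: s => //.
  by apply: filter_forall => j; have [] := HK j.
have [B1 B10 HB1] := near_infinity N0 nearP.
have C1 := C01; have C00 : 0 < C0 by lra.
have A10 : 0 < A1 by lra.
have [c c0 Hc] : exists2 c : R, 0 < c &
    forall q x : R, 0 < q -> C0^-1 * q <= x <= A1 * q -> c * q `^ nu <= x `^ nu.
  by apply: powR_comparable; rewrite ?invr_gt0.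
(* The two entries serve the far and the near region; the 2 comes from P + Q <= 2 max(P, Q). *)
pose A' := Num.min 1 (A * c / (2 * K1)).
have A'0 : 0 < A' by rewrite lt_min ltr01 divr_gt0 ?mulr_gt0.
exists A', (C0 * (1 + B + B1)); split=> //; first by rewrite mulr_gt0//; lra.
move=> z _ Bz; rewrite maxnorm_gradient.
set x := z 0 0; set y := z 0 1.
have zE : maxnorm z = Num.max (nrm x) (nrm y) by rewrite maxnorm2.
have Cz : C0 < maxnorm z.
  apply: le_lt_trans Bz; rewrite ler_peMr ?ltW//; lra.
rewrite {1}zE in Cz; have [[yfar y1 ymax]|[ynear zx]] := far_or_near Cz.
  rewrite le_max; apply/orP; right; apply: le_trans (far yfar).
  rewrite zE ymax -powR_mulrn ?nrm_ge0//.
  apply: (@le_trans _ _ (1 * nrm y `^ nu)); last by rewrite mul1r ler_powR.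
  by rewrite ler_wpM2r ?powR_ge0// ge_min lexx.
have xB : 1 + B + B1 < nrm x.
  by rewrite -(ltr_pM2l C00) (lt_le_trans Bz)// zE.
have [|s [s0 s1 sx [Hs Hroot Hest]]] := HB1 x; first by lra.
rewrite sx in Hs Hroot Hest.
have [j near_j] := nearest_root s y; rewrite sx in near_j.
have est := Hest j y ynear near_j.
set r := x * g j s in est near_j.
pose w : 'rV[R[i]]_2 := \row_(i < 2) (if i == 0 then x else r).
have w0 : w 0 0 = x by rewrite mxE.
have w1 : w 0 1 = r by rewrite mxE.
have fyr : ev (partial_y f) x r = 0.
  by rewrite Hs (bigD1 j)//= subrr mul0r mulr0.
have wE : maxnorm w = Num.max (nrm x) (nrm r) by rewrite maxnorm2 w0 w1.
have Sw : polar_curve_y f w by rewrite /polar_curve_y /= /eval2 w0 w1.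
have Bw : B < maxnorm w by rewrite wE lt_max; apply/orP; left; lra.
have := H w Sw Bw.
rewrite maxnorm_gradient w0 w1 fyr nrm0 (max_idPl (nrm_ge0 _)) => low.
have z_gt0 : 0 < maxnorm z by rewrite (lt_trans _ Bz)// mulr_gt0// !addr_gt0.
have wz : c * maxnorm z `^ nu <= maxnorm w `^ nu.
  apply: Hc => //; apply/andP; split.
    rewrite mulrC ler_pdivrMr// mulrC zE (le_trans zx)// ler_wpM2l ?(ltW C00)//.
    by rewrite wE le_max lexx.
  have xz : nrm x <= maxnorm z by rewrite zE le_max lexx.
  have xz' : A1 * nrm x <= A1 * maxnorm z by rewrite ler_wpM2l// ltW.
  rewrite wE ge_max (le_trans (Hroot j))// andbT (le_trans _ xz')//.
  by rewrite ler_peMl ?nrm_ge0.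
set P := nrm (ev (partial_x f) x y) in est *; set Q := nrm (ev (partial_y f) x y) in est *.
have P0 : 0 <= P by apply: nrm_ge0.
have Q0 : 0 <= Q by apply: nrm_ge0.
have PM : P <= Num.max P Q by rewrite le_max lexx.
have QM : Q <= Num.max P Q by rewrite le_max lexx orbT.
apply: (@le_trans _ _ (A * c / (2 * K1) * maxnorm z `^ nu)).
  by rewrite ler_wpM2r ?powR_ge0// ge_min lexx orbT.
rewrite mulrAC ler_pdivrMr ?mulr_gt0//.
have h1 : A * (c * maxnorm z `^ nu) <= A * maxnorm w `^ nu by rewrite ler_wpM2l// ltW.
have h2 : K j * (P + Q) <= K1 * (P + Q) by rewrite ler_wpM2r// addr_ge0.
have h3 : K1 * (P + Q) <= K1 * (2 * Num.max P Q) by rewrite ler_wpM2l ?(ltW K10)// mulr_natl mulr2n lerD.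
have -> : Num.max P Q * (2 * K1) = K1 * (2 * Num.max P Q) by ring.
by rewrite -mulrA (le_trans h1)// (le_trans low)// (le_trans est)// (le_trans h2).
Unshelve. all: by end_near. Qed.

(** Zeros of f_y of large norm lie on the branches, where |z| is comparable to |x| = |s|^-N; this
    turns the order d in s into the exponent d / N. *)
Lemma polar_exponent (d : R) :
  (forall j : 'I_m, exists2 A : R, 0 < A & \forall s \near punctured0,
     A * nrm s `^ (- d) <= nrm (ev (partial_x f) (s ^- N) (root j s))) ->
  exponents (gradient f) (polar_curve_y f) (d / N%:R).
Proof.
move=> /(_ _)/cid2 H; pose A j := s2val (H j).
have A0 j : 0 < A j by exact: s2valP (H j).
have HA j : \forall s \near punctured0,
    A j * nrm s `^ (- d) <= nrm (ev (partial_x f) (s ^- N) (root j s)) := s2valP' (H j).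
pose A1 := \big[Num.min/1]_(j < m) A j.
have A10 : 0 < A1.
  by rewrite /A1; elim/big_ind: _ => // a b a0 b0; rewrite lt_min a0.
have AA j : A1 <= A j by rewrite /A1 (bigD1 j)//= ge_min lexx.
have nearP : \forall s \near punctured0,
   (forall y, ev (partial_y f) (s ^- N) y = u * \prod_(i < m) (y - root i s)) /\
   forall j : 'I_m, A j * nrm s `^ (- d) <= nrm (ev (partial_x f) (s ^- N) (root j s)).
  by near=> s; split; near: s => //; apply: filter_forall.
have [B1 B10 HB1] := near_infinity N0 nearP.
have C1 := C01; have C00 : 0 < C0 by lra.
have C0V : 0 < C0^-1 by rewrite invr_gt0.
have [c c0 Hc] := powR_comparable (d / N%:R) C0V (@ltr01 R).
exists (A1 * c), (C0 * (1 + B1)); split; first by rewrite mulr_gt0.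
  by rewrite mulr_gt0//; lra.
move=> z Sz Bz; rewrite maxnorm_gradient.
set x := z 0 0; set y := z 0 1.
have fy0 : ev (partial_y f) x y = 0 by exact: Sz.
have zE : maxnorm z = Num.max (nrm x) (nrm y) by rewrite maxnorm2.
have Cz : C0 < maxnorm z by apply: le_lt_trans Bz; rewrite ler_peMr ?ltW//; lra.
rewrite {1}zE in Cz; have [[yfar y1 _]|[ynear zx]] := far_or_near Cz.
  (* The far region contains no zero of f_y. *)
  exfalso; have := far yfar; rewrite fy0 nrm0 leNgt => /negP; apply.
  by rewrite exprn_gt0//; lra.
have xB : 1 + B1 < nrm x by rewrite -(ltr_pM2l C00) (lt_le_trans Bz)// zE.
have [|s [s0 s1 sx [Hs Hlow]]] := HB1 x; first by lra.
rewrite sx in Hs Hlow.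
have s_gt0 : 0 < nrm s by rewrite nrm_gt0.
have [j yj] : exists j : 'I_m, y = x * g j s.
  have /eqP := Hs y; rewrite fy0 eq_sym mulf_eq0 (negbTE u0) /= => /prodf_eq0[j _].
  by rewrite subr_eq0 => /eqP; exists j.
rewrite fy0 nrm0 (max_idPl (nrm_ge0 _)) yj.
apply: le_trans (Hlow j).
have xs : nrm x `^ (d / N%:R) = nrm s `^ (- d).
  rewrite -sx nrmV nrmX -powR_mulrn ?nrm_ge0// -powRN -powRrM; congr (_ `^ _).
  by field; rewrite pnatr_eq0 -lt0n.
have z_gt0 : 0 < maxnorm z by rewrite (lt_trans _ Bz)// mulr_gt0// addr_gt0.
have xz : c * maxnorm z `^ (d / N%:R) <= nrm x `^ (d / N%:R).
  apply: Hc => //; apply/andP; split; last by rewrite mul1r zE le_max lexx.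
  by rewrite mulrC ler_pdivrMr// mulrC zE.
rewrite -xs -mulrA; apply: ler_pM => //; first exact: ltW.
by rewrite mulr_ge0 ?powR_ge0// ltW.
Unshelve. all: by end_near. Qed.

End Polar.

Section PolarBranch.
Variable R : realType.
Variables (f : {poly {poly R[i]}}) (N : nat) (g : R[i] -> R[i]).
Hypothesis Hg : analytic g.
Hypothesis fy0 : \forall s \near punctured0, ev (partial_y f) (s ^- N) (s ^- N * g s) = 0.

(** The parameter is t = 1/s, so that a germ at s = 0 becomes a curve meromorphic at infinity. *)
Definition branch (t : R[i]) : 'rV[R[i]]_2 :=
  \row_(i < 2) (if i == 0 then t ^+ N else t ^+ N * g t^-1).

Lemma branch_x s : branch s^-1 0 0 = s ^- N.
Proof. by rewrite mxE exprVn. Qed.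

Lemma branch_y s : branch s^-1 0 1 = s ^- N * g s.
Proof. by rewrite mxE exprVn invrK. Qed.

Lemma branch_meromorphic i : meromorphic_at_infty (fun t => branch t 0 i).
Proof.
have [root' Hroot] := mero_branch N Hg.
case: (eqVneq i 0) => [->|i0].
  apply: (@meromorphic_of_mero _ _ (fun s => - N%:R * s ^- N)).
  rewrite (_ : (fun s => _) = fun s => s ^- N); first exact: mero_pole.
  by apply/funext => s; rewrite branch_x.
apply: (@meromorphic_of_mero _ _ root').
rewrite (_ : (fun s => _) = fun s => s ^- N * g s)//; apply/funext => s.
by rewrite -branch_y; congr (branch _ 0 _); case: i i0 => -[|[|]]// ? _; apply: val_inj.
Qed.

(** As g is bounded near 0, the second coordinate is at most a multiple of the first, t^N, which
    decides the degree. *)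
Lemma degree_branch : degree_tuple branch = (N%:R)%:E.
Proof.
apply: grows_uniq (degree_tuple_grows branch_meromorphic) _ => /=.
have [A A0 HA] := analytic_bounded Hg.
exists 1, (1 + A); split=> //; first by rewrite addr_gt0.
near=> s; rewrite maxnorm2 branch_x branch_y nrmM.
have -> : nrm s `^ (- N%:R) = nrm (s ^- N) by rewrite powRN powR_mulrn ?nrm_ge0// nrmV nrmX.
have gA : nrm (g s) <= A by near: s.
rewrite mul1r le_max lexx /= ge_max ler_peMl ?nrm_ge0 ?lerDl ?(ltW A0)//=.
by rewrite mulrC ler_wpM2r ?nrm_ge0// (le_trans gA)// lerDr.
Unshelve. all: by end_near. Qed.

Lemma degree_gradient_branch d :
  grows d (fun s => nrm (ev (partial_x f) (s ^- N) (s ^- N * g s))) ->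
  degree_tuple (gradient f \o branch) = d.
Proof.
move=> Hd.
have HG i : meromorphic_at_infty (fun t => (gradient f \o branch) t 0 i).
  exact: (gradient_meromorphic f branch_meromorphic).
apply: grows_uniq (degree_tuple_grows HG) _; apply: grows_eq Hd.
near=> s; rewrite /comp maxnorm_gradient branch_x branch_y.
have -> : ev (partial_y f) (s ^- N) (s ^- N * g s) = 0 by near: s.
by rewrite nrm0 (max_idPl (nrm_ge0 _)).
Unshelve. all: by end_near. Qed.

(* Along the branch, the Euler derivative of f is - N x f_x, so f has a finite
   limit as soon as f_x decays at least like 1 / x. *)
Lemma branch_limit d : (d <= (- N%:R)%:E)%E ->
  grows d (fun s => nrm (ev (partial_x f) (s ^- N) (s ^- N * g s))) ->
  exists l, (degree_at_infty (fun t => eval2 f (branch t) - l)%R < 0)%E.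
Proof.
move=> dN Hd; have [root' Hroot] := mero_branch N Hg.
have Hf := mero_ev f (mero_pole R N) Hroot.
(* The condition d <= -N says that f_x is O(|s|^N), which compensates x = s^-N in the Euler
   derivative of f. *)
have [B HB] : exists B, \forall s \near punctured0,
    nrm (ev (partial_x f) (s ^- N) (s ^- N * g s)) <= B * nrm s ^+ N.
  case: d dN Hd => [r||]//= rN; last first.
    move=> H; exists 1; apply: filterS H => s ->.
    by rewrite mul1r exprn_ge0 ?nrm_ge0.
  move=> [A [B [A0 B0 H]]]; exists B; near=> s.
  have s_gt0 : 0 < nrm s by rewrite nrm_gt0; near: s; exact: punctured0_neq0.
  have s1 : nrm s <= 1 by apply/ltW; near: s; exact: punctured0_lt.
  have /andP[_ h] : A * nrm s `^ (- r) <= nrm (ev (partial_x f) (s ^- N) (s ^- N * g s)) <=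
      B * nrm s `^ (- r) by near: s.
  rewrite (le_trans h)// ler_wpM2l ?(ltW B0)// -powR_mulrn ?nrm_ge0// -[N%:R]opprK.
  by apply: powR_le_small; rewrite ?s_gt0// -lee_fin.
have [|l [C [C0 HC]]] := mero_limit (B := N%:R * B) Hf.
  near=> s; have s0 : s != 0 by near: s; exact: punctured0_neq0.
  have -> : ev (partial_y f) (s ^- N) (s ^- N * g s) = 0 by near: s.
  rewrite mul0r addr0 mulNr mulrN nrmN !nrmM nrm_nat nrmV nrmX mulrCA ler_wpM2l//.
  rewrite ler_pdivrMr ?exprn_gt0 ?nrm_gt0//.
  by near: s.
exists l.
have Hmer : meromorphic_at_infty (fun t => eval2 f (branch t) - l).
  apply: meromorphic_of_mero.
  rewrite (_ : (fun s => _) = fun s => ev f (s ^- N) (s ^- N * g s) + - l).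
    exact: meroD Hf (mero_euler (euler_cst _)).
  by apply/funext => s; rewrite /eval2 branch_x branch_y.
(* Since f - l is O(|s|) along the branch, its degree is at most -1. *)
apply: (@le_lt_trans _ _ (-1)%:E); last by rewrite lte_fin ltrN10.
apply: (@grows_le _ _ _ _ (fun s => C * nrm s) (degree_grows Hmer)).
  exists C, C; split=> //; apply: nearW => s.
  by rewrite opprK powRr1 ?nrm_ge0// lexx.
by near=> s; rewrite /eval2 branch_x branch_y; near: s.
Unshelve. all: by end_near. Qed.

End PolarBranch.

Lemma coef_monic_y (A : comNzRingType) n (a : nat -> {poly A}) j : (j <= n)%N ->
  ('X^n + \sum_(1 <= i < n.+1) (a i)%:P * 'X^(n - i) : {poly {poly A}})`_j =
  if j == n then 1 else a (n - j)%N.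
Proof.
move=> jn; rewrite coefD coefXn coef_sum.
under eq_bigr do rewrite coefCM coefXn.
case: eqP => [->|/eqP jn']; rewrite ?add0r.
  rewrite big_nat big1 ?addr0// => i /andP[i0 iN].
  by rewrite (_ : (n == n - i)%N = false) ?mulr0//; lia.
have j_lt : (j < n)%N by rewrite ltn_neqAle jn'.
rewrite (bigD1_seq (n - j)%N) ?iota_uniq//=; last by rewrite mem_index_iota; lia.
rewrite subKn// eqxx mulr1 big_seq_cond big1 ?addr0// => i.
rewrite mem_index_iota => /andP[/andP[i0 iN] inj].
by rewrite (_ : (j == n - i)%N = false) ?mulr0//; lia.
Qed.

Theorem corollary3p6 (R : realType) (n : nat) (a : nat -> {poly R[i]})
    (f : {poly {poly R[i]}})
    (hn : (1 < n)%N)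
    (ha : forall i : nat, (1 <= i <= n)%N -> (size (a i) <= i.+1)%N)
    (hf : f = 'X^n + \sum_(1 <= i < n.+1) (a i)%:P * 'X^(n - i))
    (hL : (lojasiewicz (gradient f) [set: 'rV[R[i]]_2] <= (-1)%:E)%E) :
  (exists lambda0 : R[i],
     lojasiewicz (gradient f) [set: 'rV[R[i]]_2] = lojasiewicz_at f lambda0) /\
  lojasiewicz (gradient f) [set: 'rV[R[i]]_2] =
    lojasiewicz (gradient f) (polar_curve_y f).
Proof.
have [m nm] : exists m, n = m.+1 by exists n.-1; rewrite prednK// ltnW.
have m0 : (0 < m)%N by rewrite -ltnS -nm.
pose u : R[i] := n%:R.
have u0 : u != 0 by rewrite pnatr_eq0 nm.
have u2 : 2 <= nrm u by rewrite nrm_nat ler_nat.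
have coef_f j : (j <= n)%N -> f`_j = if j == n then 1 else a (n - j)%N.
  by rewrite hf; apply: coef_monic_y.
have sf : (size f <= n.+1)%N.
  rewrite hf (leq_trans (size_polyD _ _))// geq_max size_polyXn leqnn /=.
  rewrite (leq_trans (size_sum _ _ _))//; apply/bigmax_leqP_seq => i _ _.
  rewrite (leq_trans (size_polyMleq _ _))// size_polyXn.
  have := size_polyC_leq1 (a i); lia.
have sF : (size (partial_y f) <= m.+1)%N.
  by rewrite (leq_trans (size_poly _ _))// -subn1 leq_subLR add1n -nm.
have Fm : (partial_y f)`_m = u%:P.
  by rewrite coef_deriv -nm coef_f// eqxx -polyC1 -polyCMn.
have Fj j : (j < m)%N -> (size ((partial_y f)`_j)%R <= (m - j).+1)%N.
  move=> jm; rewrite coef_deriv coef_f; last by rewrite nm ltnW.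
  rewrite {1 2}nm eqSS (ltn_eqF jm) subSS -scaler_nat.
  by rewrite (leq_trans (size_scale_leq _ _))// ha// nm; lia.
have [C0 C01 far] := far_bound sF Fm Fj u2.
have [N [g [N0 Hg splitH]]] := puiseux_infty u0 sF Fm Fj.
set L := lojasiewicz _ setT in hL *.
have polar : L = lojasiewicz (gradient f) (polar_curve_y f).
  apply/eqP; rewrite eq_le; apply/andP; split.
    apply: le_ereal_sup => _ [nu [A [B [A0 B0 H]]] <-]; exists nu => //.
    by exists A, B; split=> // z _; apply: H.
  apply: ge_ereal_sup => _ [nu Hnu <-].
  have [num|mnu] := leP nu m%:R.
    apply: ereal_sup_ubound; exists nu => //.
    exact: (exponents_polar N0 m0 Hg splitH C01 far num Hnu).
  (* An exponent above m on the polar curve would make m an exponent on the whole plane, against L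
     <= -1. *)
  exfalso; have Hm := exponents_down (ltW mnu) Hnu.
  have : (m%:R%:E <= L)%E.
    apply: ereal_sup_ubound; exists m%:R => //.
    exact: (exponents_polar N0 m0 Hg splitH C01 far (lexx _) Hm).
  move=> /le_trans/(_ hL); rewrite lee_fin.
  by have := ler0n R m; lra.
split=> //.
pose G j s := nrm (ev (partial_x f) (s ^- N) (s ^- N * g j s)).
have /choice[d Hd] : forall j, exists d, grows d (G j).
  move=> j; have [root' Hroot] := mero_branch N (Hg j).
  exact: mero_grows (mero_ev (partial_x f) (mero_pole R N) Hroot).
(* The selected branch is one on which f_x has the least growth. *)
case: (@Order.TotalTheory.arg_minP _ _ _ (Ordinal m0) xpredT (fun j : 'I_m => d j) isT)
  => j0 _ min_j0.
have fy0 : \forall s \near punctured0, ev (partial_y f) (s ^- N) (s ^- N * g j0 s) = 0.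
  by apply: filterS splitH => s ->; rewrite (bigD1 j0)//= subrr mul0r mulr0.
have NR : 0 < N%:R :> R by rewrite ltr0n.
(* The minimal growth bounds f_x from below on all branches at once, so d / N is an exponent on the
   polar curve; if f_x vanishes along the branch, the left side is -oo. *)
have dL : (d j0 / N%:R%:E <= L)%E.
  have := Hd j0; case E : (d j0) => [r||]// _; last first.
    by rewrite inver gt_eqF// gt0_mulNye ?leNye// lte_fin invr_gt0.
  rewrite inver gt_eqF// -EFinM polar; apply: ereal_sup_ubound; exists (r / N%:R) => //.
  apply: (polar_exponent N0 u0 splitH C01 far) => j.
  have := Hd j; have := min_j0 j isT; rewrite E.
  case: (d j) => [q||]//; rewrite lee_fin => rq [A [B [A0 _ H]]].
  exists A => //; near=> s.
  have s_gt0 : 0 < nrm s by rewrite nrm_gt0; near: s; exact: punctured0_neq0.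
  have s1 : nrm s <= 1 by apply/ltW; near: s; exact: punctured0_lt.
  have /andP[h _] : A * nrm s `^ (- q) <= G j s <= B * nrm s `^ (- q) by near: s.
  apply: le_trans h; rewrite ler_wpM2l ?(ltW A0)//.
  by apply: powR_le_small; rewrite ?s_gt0.
have dN : (d j0 <= (- N%:R)%:E)%E.
  have := le_trans dL hL; rewrite inver gt_eqF// lee_pdivrMr//.
  by rewrite -EFinM mulN1r.
have [l Hl] := branch_limit (Hg j0) fy0 dN (Hd j0).
(* The chain L <= L_l <= d / N <= L closes up: the middle inequality tests the infimum on the
   selected branch. *)
exists l; apply/eqP; rewrite eq_le lojasiewicz_le_at /=.
apply: le_trans dL; apply: ereal_inf_lbound; exists (branch N (g j0)).
  split=> //; first by move=> i; apply: branch_meromorphic.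
  by rewrite degree_branch// lte_fin.
by rewrite (degree_gradient_branch (Hg j0) fy0 (Hd j0)) degree_branch.
Unshelve. all: by end_near. Qed.
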